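(* Let $X$ be a perfect complex over a commutative Noetherian ring $R$. Then there exists a unique decomposition (unique up to isomorphism of the summands and permutation of the indices) in $D^b(\mathrm{proj}\,R)$ $$X\;\cong\;\bigoplus_{i\in I}X_i$$ such that the supports $\operatorname{Supp}(X_i)$ are pairwise disjoint and indecomposable.
   Context: $D^b(\mathrm{proj}\,R)$ is the full subcategory of the derived category $D(R)$ consisting of complexes quasi-isomorphic to perfect complexes (bounded complexes of finitely generated projective modules). For a complex $X$, $\operatorname{Supp}(X)=\{p\in\operatorname{Spec}(R): X\otimes_R R_p\neq 0\}$, where nonvanishing is in the derived category. For $R$ Noetherian, a thick support is a specialisation closed subset of $\operatorname{Spec}(R)$, i.e. a union of Zariski closed subsets. A thick decomposition of a thick support $S$ is an expression $S=\bigcup_i S_i$ with the $S_i$ pairwise disjoint thick supports. A thick support is indecomposable if it is nonempty and admits no thick decomposition into two nonempty thick supports. *)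

(* Defs.v *)
From HB Require Import structures.
From mathcomp Require Import all_boot all_order all_algebra.
From mathcomp Require Import ring.
From mathcomp Require Import boolp classical_sets cardinality.

Set Implicit Arguments.
Unset Strict Implicit.
Unset Printing Implicit Defensive.

Import GRing.Theory.

Local Open Scope classical_set_scope.
Local Open Scope ring_scope.
Local Open Scope quotient_scope.

(* Rings are [comPzRingType]s, so that the zero ring is allowed. This is why
   [idealr] and [prime_idealr] of [ring_quotient], which require a
   [nzRingType], are not used. *)

Section Spectrum.
Variable R : comPzRingType.

Record is_ideal (I : set R) : Prop := IsIdeal {
  ideal0 : I 0;
  idealD : forall x y, I x -> I y -> I (x + y);
  idealM : forall a x, I x -> I (a * x) }.

Definition noetherian : Prop := forall I : set R, is_ideal I ->
  exists s : seq R,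
    I = [set x | exists c : nat -> R, x = \sum_(i < size s) c i * s`_i].

Record Spec : Type := MkSpec {
  spec_set :> set R;
  spec_ideal : is_ideal spec_set;
  spec_proper : ~ spec_set 1;
  spec_prime : forall x y,
    spec_set (x * y) -> spec_set x \/ spec_set y }.

Definition zariski_closed (C : set Spec) : Prop :=
  exists2 I : set R, is_ideal I & C = [set p : Spec | I `<=` p].

Definition thick_support (S : set Spec) : Prop :=
  exists2 F : set (set Spec),
    (forall C, F C -> zariski_closed C) & S = \bigcup_(C in F) C.

Definition thick_decomposition (I : Type) (S : set Spec) (S_ : I -> set Spec)
    : Prop :=
  [/\ forall i, thick_support (S_ i),
      trivIset setT S_ &
      S = \bigcup_i S_ i].

Definition indecomposable (S : set Spec) : Prop :=
  [/\ thick_support S, S !=set0 &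
      ~ exists S_ : bool -> set Spec,
          thick_decomposition S S_ /\ forall b, S_ b !=set0].

End Spectrum.

Section FiniteProjective.
Variable R : comPzRingType.

Definition fin_gen (M : lmodType R) : Prop :=
  exists s : seq M, forall x : M,
    exists c : nat -> R, x = \sum_(i < size s) c i *: s`_i.

Definition projective (P : lmodType R) : Prop :=
  forall (M N : lmodType R) (g : {linear M -> N}) (f : {linear P -> N}),
    (forall y, exists x, g x = y) ->
    exists h : {linear P -> M}, forall x, g (h x) = f x.

End FiniteProjective.

Section DirectSum.
Variables (R : comPzRingType) (I : Type) (M : I -> lmodType R).

Record dsum : Type := Dsum {
  dval :> forall i, M i;
  dvalP : finite_set [set i | dval i != 0] }.

HB.instance Definition _ := gen_eqMixin dsum.
HB.instance Definition _ := gen_choiceMixin dsum.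

Lemma dsum_ext (x y : dsum) : (forall i, x i = y i) -> x = y.
Proof.
case: x y => [x px] [y py] /= xy.
have e := functional_extensionality_dep xy.
by subst y; congr Dsum; exact: Prop_irrelevance.
Qed.

Lemma dsum0_subproof : finite_set [set i | (0 : M i) != 0].
Proof. by apply: (sub_finite_set _ (finite_set0 I)) => i /=; rewrite eqxx. Qed.
Definition dsum0 := Dsum dsum0_subproof.

Lemma dsumD_subproof (x y : dsum) : finite_set [set i | x i + y i != 0].
Proof.
have fxy : finite_set ([set i | x i != 0] `|` [set i | y i != 0]).
  by rewrite finite_setU; split; exact: dvalP.
apply: (sub_finite_set _ fxy) => i /=.
case: (eqVneq (x i) 0) => [->|]; last by left.
by rewrite add0r; right.
Qed.
Definition dsumD x y := Dsum (dsumD_subproof x y).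

Lemma dsumZ_subproof (a : R) (x : dsum) : finite_set [set i | a *: x i != 0].
Proof.
apply: (sub_finite_set _ (dvalP x)) => i /=.
by case: (eqVneq (x i) 0) => [->|//]; rewrite scaler0 eqxx.
Qed.
Definition dsumZ a x := Dsum (dsumZ_subproof a x).

Definition dsumN x := dsumZ (- 1) x.

Lemma dsumA : associative dsumD.
Proof. by move=> x y z; apply: dsum_ext => i /=; rewrite addrA. Qed.
Lemma dsumC : commutative dsumD.
Proof. by move=> x y; apply: dsum_ext => i /=; rewrite addrC. Qed.
Lemma dsum0D : left_id dsum0 dsumD.
Proof. by move=> x; apply: dsum_ext => i /=; rewrite add0r. Qed.
Lemma dsumND : left_inverse dsum0 dsumN dsumD.
Proof. by move=> x; apply: dsum_ext => i /=; rewrite scaleN1r addNr. Qed.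
HB.instance Definition _ := GRing.isZmodule.Build dsum dsumA dsumC dsum0D dsumND.

Lemma dsumZA a b x : dsumZ a (dsumZ b x) = dsumZ (a * b) x.
Proof. by apply: dsum_ext => i /=; rewrite scalerA. Qed.
Lemma dsum1Z : left_id 1 dsumZ.
Proof. by move=> x; apply: dsum_ext => i /=; rewrite scale1r. Qed.
Lemma dsumZDr : right_distributive dsumZ +%R.
Proof. by move=> a x y; apply: dsum_ext => i /=; rewrite scalerDr. Qed.
Lemma dsumZDl x : {morph dsumZ^~ x : a b / a + b}.
Proof. by move=> a b; apply: dsum_ext => i /=; rewrite scalerDl. Qed.
HB.instance Definition _ :=
  GRing.Zmodule_isLmodule.Build R dsum dsumZA dsum1Z dsumZDr dsumZDl.

End DirectSum.

Section DirectSumMap.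
Variables (R : comPzRingType) (I : Type) (M N : I -> lmodType R).
Variable f : forall i, {linear M i -> N i}.

Lemma dsum_map_subproof (x : dsum M) : finite_set [set i | f i (x i) != 0].
Proof.
apply: (sub_finite_set _ (dvalP x)) => i /=.
by case: (eqVneq (x i) 0) => [->|//]; rewrite linear0 eqxx.
Qed.
Definition dsum_map (x : dsum M) : dsum N := Dsum (dsum_map_subproof x).

Lemma dsum_map_linear : linear dsum_map.
Proof. by move=> a x y; apply: dsum_ext => i /=; rewrite linearP. Qed.
HB.instance Definition _ :=
  GRing.isLinear.Build R (dsum M) (dsum N) *:%R dsum_map dsum_map_linear.

End DirectSumMap.

(* M ⊗_R N by generators and relations: an element is a finite sum
   m_1 ⊗ n_1 + ... + m_k ⊗ n_k, represented by the list of the (m_j, n_j), and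
   [tens_eq] is the smallest additive congruence for which ⊗ is R-balanced
   biadditive. Addition is concatenation and R acts on the left factors. *)
Section TensorProduct.
Variables (R : comPzRingType) (M N : lmodType R).

Inductive tens_eq : seq (M * N) -> seq (M * N) -> Prop :=
| tens_refl s : tens_eq s s
| tens_sym s t : tens_eq s t -> tens_eq t s
| tens_trans s t u : tens_eq s t -> tens_eq t u -> tens_eq s u
| tens_cat s s' t t' :
    tens_eq s s' -> tens_eq t t' -> tens_eq (s ++ t) (s' ++ t')
| tens_catC s t : tens_eq (s ++ t) (t ++ s)
| tens_0l n : tens_eq [:: (0, n)] [::]
| tens_Dl m m' n : tens_eq [:: (m + m', n)] [:: (m, n); (m', n)]
| tens_Dr m n n' : tens_eq [:: (m, n + n')] [:: (m, n); (m, n')]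
| tens_bal a m n : tens_eq [:: (a *: m, n)] [:: (m, a *: n)].

Definition tens_eqb (s t : seq (M * N)) : bool := `[< tens_eq s t >].

Lemma tens_eqb_refl : reflexive tens_eqb.
Proof. by move=> s; apply/asboolP; exact: tens_refl. Qed.
Lemma tens_eqb_sym : symmetric tens_eqb.
Proof. by move=> s t; apply/asboolP/asboolP; exact: tens_sym. Qed.
Lemma tens_eqb_trans : transitive tens_eqb.
Proof. by move=> s t u /asboolP st /asboolP /(tens_trans st) /asboolP. Qed.

Canonical tens_equiv :=
  EquivRel tens_eqb tens_eqb_refl tens_eqb_sym tens_eqb_trans.

Definition tensor := {eq_quot tens_equiv}.
HB.instance Definition _ := Choice.on tensor.

Definition tens_pi (s : seq (M * N)) : tensor := \pi_tensor s.

Lemma tens_piP s t : tens_eq s t <-> tens_pi s = tens_pi t.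
Proof.
split=> [st|/eqP]; first by apply/eqmodP/asboolP.
by move=> /eqP /eqmodP /asboolP.
Qed.

Lemma tens_piK (x : tensor) : tens_pi (repr x) = x.
Proof. exact: reprK. Qed.

Definition lscale (a : R) (s : seq (M * N)) := [seq (a *: u.1, u.2) | u <- s].

Lemma lscale_eq a s t : tens_eq s t -> tens_eq (lscale a s) (lscale a t).
Proof.
elim=> {s t} //=.
- by move=> s; exact: tens_refl.
- by move=> s t _; exact: tens_sym.
- by move=> s t u _ st _; exact: tens_trans.
- by move=> s s' t t' _ ss' _ tt'; rewrite /lscale !map_cat; exact: tens_cat.
- by move=> s t; rewrite /lscale !map_cat; exact: tens_catC.
- by move=> n; rewrite scaler0; exact: tens_0l.
- by move=> m m' n; rewrite scalerDr; exact: tens_Dl.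
- by move=> m n n'; exact: tens_Dr.
- by move=> b m n; rewrite scalerA mulrC -scalerA; exact: tens_bal.
Qed.

Lemma lscale0_eq s : tens_eq (lscale 0 s) [::].
Proof.
elim: s => [|[m n] s IH] /=; first exact: tens_refl.
by rewrite scale0r; exact: (tens_cat (tens_0l n) IH).
Qed.

Lemma lscaleDl_eq a b s : tens_eq (lscale (a + b) s) (lscale a s ++ lscale b s).
Proof.
elim: s => [|[m n] s IH] /=; first exact: tens_refl.
rewrite scalerDl.
apply: tens_trans (tens_cat (tens_Dl (a *: m) (b *: m) n) IH) _.
apply: (tens_cat (tens_refl [:: (a *: m, n)])).
rewrite -[(b *: m, n) :: lscale b s]cat1s -[_ :: _]cat1s !catA.
by apply: tens_cat (tens_refl _); exact: tens_catC.
Qed.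

Definition tens0 : tensor := tens_pi [::].
Definition tensD (x y : tensor) : tensor := tens_pi (repr x ++ repr y).
Definition tensZ (a : R) (x : tensor) : tensor := tens_pi (lscale a (repr x)).
Definition tensN (x : tensor) : tensor := tensZ (- 1) x.

Lemma tens_repr_pi s : tens_eq (repr (tens_pi s)) s.
Proof. by apply/tens_piP; rewrite tens_piK. Qed.

Lemma tensDE s t : tensD (tens_pi s) (tens_pi t) = tens_pi (s ++ t).
Proof. by apply/tens_piP; apply: tens_cat; exact: tens_repr_pi. Qed.

Lemma tensZE a s : tensZ a (tens_pi s) = tens_pi (lscale a s).
Proof. by apply/tens_piP/lscale_eq; exact: tens_repr_pi. Qed.

Lemma lscale1 s : lscale 1 s = s.
Proof.
by rewrite -[RHS]map_id; apply: eq_map => -[m n] /=; rewrite scale1r.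
Qed.

Lemma tensDA : associative tensD.
Proof.
by move=> x y z; rewrite -(tens_piK x) -(tens_piK y) -(tens_piK z) !tensDE catA.
Qed.
Lemma tensDC : commutative tensD.
Proof.
move=> x y; rewrite -(tens_piK x) -(tens_piK y) !tensDE.
by apply/tens_piP; exact: tens_catC.
Qed.
Lemma tens0D : left_id tens0 tensD.
Proof. by move=> x; rewrite -(tens_piK x) tensDE. Qed.
Lemma tensND : left_inverse tens0 tensN tensD.
Proof.
move=> x; rewrite -(tens_piK x) /tensN tensZE tensDE.
rewrite -{2}[repr x]lscale1; apply/tens_piP.
apply: tens_trans (tens_sym (lscaleDl_eq _ _ _)) _.
by rewrite addNr; exact: lscale0_eq.
Qed.
HB.instance Definition _ :=
  GRing.isZmodule.Build tensor tensDA tensDC tens0D tensND.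

Lemma tensZA a b x : tensZ a (tensZ b x) = tensZ (a * b) x.
Proof.
rewrite -(tens_piK x) !tensZE; congr tens_pi; rewrite /lscale -map_comp.
by apply: eq_map => -[m n] /=; rewrite scalerA.
Qed.
Lemma tens1Z : left_id 1 tensZ.
Proof. by move=> x; rewrite -(tens_piK x) tensZE lscale1. Qed.
Lemma tensZDr : right_distributive tensZ +%R.
Proof.
move=> a x y; rewrite -(tens_piK x) -(tens_piK y) [_ + _]tensDE !tensZE.
by rewrite [_ + _]tensDE /lscale map_cat.
Qed.
Lemma tensZDl x : {morph tensZ^~ x : a b / a + b}.
Proof.
move=> a b; rewrite -(tens_piK x) !tensZE [_ + _ in RHS]tensDE.
by apply/tens_piP; exact: lscaleDl_eq.
Qed.
HB.instance Definition _ :=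
  GRing.Zmodule_isLmodule.Build R tensor tensZA tens1Z tensZDr tensZDl.

End TensorProduct.

Section TensorMap.
Variables (R : comPzRingType) (M M' N : lmodType R) (f : {linear M -> M'}).

Definition lmap (s : seq (M * N)) : seq (M' * N) :=
  [seq (f u.1, u.2) | u <- s].

Lemma lmap_eq s t : tens_eq s t -> tens_eq (lmap s) (lmap t).
Proof.
elim=> {s t} //=.
- by move=> s; exact: tens_refl.
- by move=> s t _; exact: tens_sym.
- by move=> s t u _ st _; exact: tens_trans.
- by move=> s s' t t' _ ss' _ tt'; rewrite /lmap !map_cat; exact: tens_cat.
- by move=> s t; rewrite /lmap !map_cat; exact: tens_catC.
- by move=> n; rewrite linear0; exact: tens_0l.
- by move=> m m' n; rewrite linearD; exact: tens_Dl.
- by move=> m n n'; exact: tens_Dr.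
- by move=> b m n; rewrite linearZ; exact: tens_bal.
Qed.

Definition tens_map (x : tensor M N) : tensor M' N := tens_pi (lmap (repr x)).

Lemma tens_mapE s : tens_map (tens_pi s) = tens_pi (lmap s).
Proof. by apply/tens_piP/lmap_eq; exact: tens_repr_pi. Qed.

Lemma tens_map_linear : linear tens_map.
Proof.
move=> a x y; rewrite -(tens_piK x) -(tens_piK y).
rewrite [a *: _]tensZE [_ + _]tensDE !tens_mapE.
rewrite [a *: _]tensZE [_ + _]tensDE /lmap /lscale map_cat -!map_comp.
by congr (tens_pi (_ ++ _)); apply: eq_map => -[m n] /=; rewrite linearZ.
Qed.
HB.instance Definition _ :=
  GRing.isLinear.Build R (tensor M N) (tensor M' N) *:%R tens_map
    tens_map_linear.

End TensorMap.

(* R_p, as an R-module: fractions a / s with s outside p, where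
   a / s = b / t iff u (t a - s b) = 0 for some u outside p. *)
Section Localization.
Variables (R : comPzRingType) (p : Spec R).

Definition denom : Type := {s : R | s \in ~` (p : set R)}.

Definition dnm (s : denom) : R := val s.

Lemma denomP (s : denom) : ~ spec_set p (dnm s).
Proof. by case: s => s i; exact: set_mem i. Qed.

Lemma denom1_subproof : 1 \in ~` (p : set R).
Proof. exact/mem_set/spec_proper. Qed.
Definition denom1 : denom := exist _ 1 denom1_subproof.

Lemma denomM_subproof (s t : denom) : dnm s * dnm t \in ~` (p : set R).
Proof. by apply/mem_set => /spec_prime [] /denomP. Qed.
Definition denomM (s t : denom) : denom :=
  exist _ (dnm s * dnm t) (denomM_subproof s t).

Lemma dnm1 : dnm denom1 = 1. Proof. by []. Qed.
Lemma dnmM s t : dnm (denomM s t) = dnm s * dnm t. Proof. by []. Qed.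

Definition frac_eq (x y : R * denom) : bool :=
  `[< exists u : denom,
        dnm u * (dnm y.2 * x.1) = dnm u * (dnm x.2 * y.1) >].

Lemma frac_eq_refl : reflexive frac_eq.
Proof. by move=> x; apply/asboolP; exists denom1. Qed.
Lemma frac_eq_sym : symmetric frac_eq.
Proof. by move=> x y; apply/asboolP/asboolP => -[u e]; exists u. Qed.
Lemma frac_eq_trans : transitive frac_eq.
Proof.
move=> [b t] [a s] [c r] /asboolP[u /= e] /asboolP[v /= e'].
apply/asboolP; exists (denomM (denomM u v) t); rewrite !dnmM /=.
transitivity (dnm v * dnm r * (dnm u * (dnm t * a))); first by ring.
rewrite e.
transitivity (dnm u * dnm s * (dnm v * (dnm r * b))); first by ring.
by rewrite e'; ring.
Qed.

Canonical frac_equiv := EquivRel frac_eq frac_eq_refl frac_eq_sym frac_eq_trans.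

Definition loc := {eq_quot frac_equiv}.
HB.instance Definition _ := Choice.on loc.

Definition frac (a : R) (s : denom) : loc := \pi_loc (a, s).

Lemma fracP a s b t :
  frac a s = frac b t <->
  exists u : denom, dnm u * (dnm t * a) = dnm u * (dnm s * b).
Proof.
split=> [/eqP|h]; first by move=> /eqP /eqmodP /asboolP.
by apply/eqmodP/asboolP.
Qed.

Lemma frac_surj (x : loc) : exists a s, x = frac a s.
Proof.
by exists (repr x).1, (repr x).2; rewrite /frac -surjective_pairing reprK.
Qed.

Definition loc0 : loc := frac 0 denom1.
Definition locD (x y : loc) : loc :=
  frac (dnm (repr y).2 * (repr x).1 + dnm (repr x).2 * (repr y).1)
       (denomM (repr x).2 (repr y).2).
Definition locZ (a : R) (x : loc) : loc := frac (a * (repr x).1) (repr x).2.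
Definition locN (x : loc) : loc := locZ (- 1) x.

Lemma repr_frac a s : exists u : denom,
  dnm u * (dnm s * (repr (frac a s)).1) = dnm u * (dnm (repr (frac a s)).2 * a).
Proof. by apply/fracP; rewrite {1}/frac -surjective_pairing reprK. Qed.

Lemma locDE a s b t :
  locD (frac a s) (frac b t) = frac (dnm t * a + dnm s * b) (denomM s t).
Proof.
rewrite /locD; have [u] := repr_frac a s; have [v] := repr_frac b t.
case: (repr _) => b' t'; case: (repr _) => a' s' /= e e'.
apply/fracP; exists (denomM u v); rewrite !dnmM /=.
transitivity (dnm v * dnm t * dnm t' * (dnm u * (dnm s * a'))
  + dnm u * dnm s * dnm s' * (dnm v * (dnm t * b'))); first by ring.
by rewrite e e'; ring.
Qed.

Lemma locZE c a s : locZ c (frac a s) = frac (c * a) s.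
Proof.
rewrite /locZ; have [u] := repr_frac a s.
case: (repr _) => a' s' /= e; apply/fracP; exists u => /=.
transitivity (c * (dnm u * (dnm s * a'))); first by ring.
by rewrite e; ring.
Qed.

Lemma frac_eqW a s b t : dnm t * a = dnm s * b -> frac a s = frac b t.
Proof. by move=> e; apply/fracP; exists denom1; rewrite e. Qed.

Lemma locDA : associative locD.
Proof.
move=> x y z; have [a [s ->]] := frac_surj x; have [b [t ->]] := frac_surj y.
have [c [r ->]] := frac_surj z; rewrite !locDE.
by apply: frac_eqW; rewrite ?dnmM ?dnm1; ring.
Qed.
Lemma locDC : commutative locD.
Proof.
move=> x y; have [a [s ->]] := frac_surj x; have [b [t ->]] := frac_surj y.
rewrite !locDE.
by apply: frac_eqW; rewrite ?dnmM ?dnm1; ring.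
Qed.
Lemma loc0D : left_id loc0 locD.
Proof.
move=> x; have [a [s ->]] := frac_surj x.
rewrite !locDE.
by apply: frac_eqW; rewrite ?dnmM ?dnm1; ring.
Qed.
Lemma locND : left_inverse loc0 locN locD.
Proof.
move=> x; have [a [s ->]] := frac_surj x.
rewrite /locN locZE !locDE.
by apply: frac_eqW; rewrite ?dnmM ?dnm1; ring.
Qed.
HB.instance Definition _ := GRing.isZmodule.Build loc locDA locDC loc0D locND.

Lemma locZA a b x : locZ a (locZ b x) = locZ (a * b) x.
Proof.
have [c [s ->]] := frac_surj x.
rewrite !locZE.
by apply: frac_eqW; rewrite ?dnmM ?dnm1; ring.
Qed.
Lemma loc1Z : left_id 1 locZ.
Proof. by move=> x; have [c [s ->]] := frac_surj x; rewrite locZE mul1r. Qed.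
Lemma locZDr : right_distributive locZ +%R.
Proof.
move=> c x y; have [a [s ->]] := frac_surj x; have [b [t ->]] := frac_surj y.
rewrite ![_ + _]locDE !locZE [RHS]locDE.
by apply: frac_eqW; rewrite ?dnmM ?dnm1; ring.
Qed.
Lemma locZDl x : {morph locZ^~ x : a b / a + b}.
Proof.
move=> a b; have [c [s ->]] := frac_surj x.
rewrite !locZE [RHS]locDE.
by apply: frac_eqW; rewrite ?dnmM ?dnm1; ring.
Qed.
HB.instance Definition _ :=
  GRing.Zmodule_isLmodule.Build R loc locZA loc1Z locZDr locZDl.

End Localization.

(* Cochain complexes of R-modules, indexed by the integers. *)
Section Complexes.
Variable R : comPzRingType.

Record complex : Type := Complex {
  obj :> int -> lmodType R;
  diff : forall n, {linear obj n -> obj (n + 1)};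
  diff_diff : forall n x, diff (n + 1) (diff n x) = 0 }.

Record cmap (X Y : complex) : Type := CMap {
  cfun :> forall n, {linear X n -> Y n};
  cfun_diff : forall n x, cfun (n + 1) (diff X n x) = diff Y n (cfun n x) }.

Lemma cmap_id_subproof (X : complex) n (x : X n) :
  (idfun : {linear _ -> _}) (diff X n x) = diff X n ((idfun : {linear _ -> _}) x).
Proof. by []. Qed.
Definition cmap_id (X : complex) : cmap X X := CMap (@cmap_id_subproof X).

Section Composition.
Variables (X Y Z : complex) (g : cmap Y Z) (f : cmap X Y).
Definition cmap_comp_fun n : {linear X n -> Z n} := g n \o f n.
Lemma cmap_comp_subproof n x :
  cmap_comp_fun (n + 1) (diff X n x) = diff Z n (cmap_comp_fun n x).
Proof. by rewrite /cmap_comp_fun /= !cfun_diff. Qed.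
Definition cmap_comp : cmap X Z := CMap cmap_comp_subproof.
End Composition.

(* [h n] is the component X^(n+1) -> Y^n of the homotopy, so that no transport
   along n - 1 + 1 = n is needed; as n varies, n + 1 runs over all degrees. *)
Definition homotopic (X Y : complex) (f g : cmap X Y) : Prop :=
  exists h : forall n, {linear X (n + 1) -> Y n},
    forall n x, f (n + 1) x - g (n + 1) x
      = diff Y n (h n x) + h (n + 1) (diff X (n + 1) x).

(* H^(n+1)(f) is injective and surjective for all n. *)
Definition quasi_iso (X Y : complex) (f : cmap X Y) : Prop :=
  forall n,
    (forall x : X (n + 1), diff X (n + 1) x = 0 ->
       (exists y, f (n + 1) x = diff Y n y) -> exists x', x = diff X n x') /\
    (forall y : Y (n + 1), diff Y (n + 1) y = 0 ->
       exists2 x : X (n + 1), diff X (n + 1) x = 0 &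
         exists y', y - f (n + 1) x = diff Y n y').

Lemma quasi_iso_id (X : complex) : quasi_iso (cmap_id X).
Proof.
move=> n; split=> [x _ [y e]|y dy]; first by exists y.
by exists y => //; exists 0; rewrite /= subrr linear0.
Qed.

Lemma quasi_iso_comp (X Y Z : complex) (g : cmap Y Z) (f : cmap X Y) :
  quasi_iso f -> quasi_iso g -> quasi_iso (cmap_comp g f).
Proof.
move=> qf qg n; have [fi fs] := qf n; have [gi gs] := qg n; split.
  move=> x dx [z e]; apply: fi => //; apply: gi; last by exists z.
  by rewrite -cfun_diff dx linear0.
move=> z dz; have [y dy [z' ez]] := gs _ dz; have [x dx [y' ey]] := fs _ dy.
exists x => //; exists (z' + g n y').
by rewrite linearD -ez -cfun_diff -ey linearB /= subrKA.
Qed.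

(* The derived category D(R), as the Verdier localization of the homotopy
   category K(R) at the quasi-isomorphisms: a morphism X -> Y is represented by
   a roof X <- apex -> Y whose left leg is a quasi-isomorphism. *)
Record roof (X Y : complex) : Type := Roof {
  apex : complex;
  lleg : cmap apex X;
  rleg : cmap apex Y;
  lleg_qis : quasi_iso lleg }.

Definition roof_eq (X Y : complex) (r r' : roof X Y) : Prop :=
  exists (V : complex) (u : cmap V (apex r)) (v : cmap V (apex r')),
    [/\ quasi_iso (cmap_comp (lleg r) u),
        homotopic (cmap_comp (lleg r) u) (cmap_comp (lleg r') v) &
        homotopic (cmap_comp (rleg r) u) (cmap_comp (rleg r') v)].

Definition roof_id (X : complex) : roof X X :=
  Roof (cmap_id X) (quasi_iso_id X).

(* [t] represents the composite in D(R) of [r] followed by [s]. *)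
Definition roof_comp (X Y Z : complex) (r : roof X Y) (s : roof Y Z)
    (t : roof X Z) : Prop :=
  exists (V : complex) (u : cmap V (apex r)) (v : cmap V (apex s))
         (qu : quasi_iso u),
    homotopic (cmap_comp (rleg r) u) (cmap_comp (lleg s) v) /\
    roof_eq t
      (Roof (cmap_comp (rleg s) v) (quasi_iso_comp qu (@lleg_qis _ _ r))).

Definition D_iso (X Y : complex) : Prop :=
  exists (r : roof X Y) (s : roof Y X),
    roof_comp r s (roof_id X) /\ roof_comp s r (roof_id Y).

Lemma zero_cpx_subproof (n : int) (x : 'rV[R]_0) :
  (\0 : {linear 'rV[R]_0 -> 'rV[R]_0}) ((\0 : {linear 'rV[R]_0 -> 'rV[R]_0}) x)
  = 0.
Proof. by []. Qed.
Definition zero_cpx : complex :=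
  @Complex (fun=> 'rV[R]_0) (fun=> \0) zero_cpx_subproof.

Definition dsum_cpx (I : Type) (X_ : I -> complex) : complex.
Proof.
refine (@Complex (fun n => dsum (fun i => X_ i n))
  (fun n => dsum_map (fun i => diff (X_ i) n)) _).
by move=> n x; apply: dsum_ext => i /=; rewrite diff_diff.
Defined.

Lemma tens_cpx_subproof (X : complex) (N : lmodType R) n (x : tensor (X n) N) :
  tens_map (diff X (n + 1)) (tens_map (diff X n) x) = 0.
Proof.
rewrite -(tens_piK x) !tens_mapE -[RHS]/(tens_pi [::]).
apply/tens_piP; elim: (repr x) => [|[m y] s IH] /=; first exact: tens_refl.
by rewrite diff_diff; exact: (tens_cat (tens_0l _ y) IH).
Qed.
Definition tens_cpx (X : complex) (N : lmodType R) : complex :=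
  @Complex (fun n => tensor (X n) N) (fun n => tens_map (N := N) (diff X n))
    (@tens_cpx_subproof X N).

Definition perfect (X : complex) : Prop :=
  (exists N : nat, forall n : int, (N < `|n|)%N -> forall x : X n, x = 0) /\
  (forall n, fin_gen (X n) /\ projective (X n)).

(* The objects of D^b(proj R). *)
Definition in_Dbproj (X : complex) : Prop :=
  exists2 P : complex, perfect P & D_iso X P.

Definition Supp (X : complex) : set (Spec R) :=
  [set p : Spec R | ~ D_iso (tens_cpx X (loc p)) zero_cpx].

Record support_decomposition (X : complex) (I : Type) (X_ : I -> complex)
    : Prop := SupportDecomposition {
  sd_obj : forall i, in_Dbproj (X_ i);
  sd_iso : D_iso X (dsum_cpx X_);
  sd_disjoint : trivIset setT (fun i => Supp (X_ i));
  sd_indecomposable : forall i, indecomposable (Supp (X_ i)) }.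

End Complexes.

(* Main.v *)
From HB Require Import structures.
Require Import Defs.
From mathcomp Require Import all_boot all_order all_algebra.
From mathcomp Require Import ring zify.
From mathcomp Require Import boolp classical_sets cardinality.

Set Implicit Arguments.
Unset Strict Implicit.
Unset Printing Implicit Defensive.

Import Order.TTheory GRing.Theory Num.Theory.

Local Open Scope classical_set_scope.
Local Open Scope ring_scope.

(** For a perfect complex X let A be the ideal of the scalars c such that
multiplication by c on X is null-homotopic. Then Supp X is the closed set V(A)
([Supp_zeros]): if X is acyclic at p, a contraction of X at p can be built one
degree at a time from the top, each time clearing finitely many denominators
outside p ([perfect_lift]).

Existence. Suppose that Supp X = V(A) is a disjoint union of two nonempty
thick supports. Because R is Noetherian, both are closed ([thick_piece_closed]),
and since they are disjoint there are a + b = 1, with a vanishing on the first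
part, b on the second, and ab nilpotent modulo A ([separate_closed]). After
replacing a and b by suitable multiples, ab itself is null-homotopic on X
([coprime_power]), so b is an idempotent endomorphism of X up to homotopy.

Such an idempotent splits by a perfect complex, and this is the heart of the
proof ([homotopy_idempotent_split]). Let d be the differential and h a homotopy
with dh + hd = ab, which may be chosen with h^2 = 0 ([null_homotopic_square]).
On the finitely generated projective module Q = (+)_n X^n the odd operator
d + h squares to ab, so d + h is a matrix factorization of ab, and adding to it
the operator equal to b in even degrees and to a in odd degrees yields an
honest idempotent q of Q. The complex with term (+)_(i >= n) X^i in degree n,
whose differential is alternately q and q - 1 cut off to the terms with
i > n, contains X up to homotopy as the part on which b is the identity. In
very negative degrees it reads ... -> Q -> Q -> Q with maps alternately q and
q - 1, hence it may be stopped there by the projective module q(Q).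

Applying this to (a, b) and to (b, a) writes X, up to quasi-isomorphism, as a
sum of two perfect complexes with strictly smaller supports ([perfect_split],
[perfect_split_supports]), and Noetherian induction concludes
([decomposition_exists]).

Uniqueness. The support of a direct sum is the union of the supports, and an
indecomposable set covered by disjoint thick supports lies in one of them, so
two decompositions have the same supports ([indecomposable_match]). If X_i and
Y_j have the same support, the composite X_i -> X -> Y_j is an isomorphism on
cohomology because the components X_i -> Y_j' and X_i' -> Y_j with j' <> j and
i' <> i vanish there: their classes are killed locally at each prime, hence
zero ([coboundary_local], [summand_iso]). To compose morphisms of the derived
category, an isomorphism between a perfect complex and an arbitrary one is
represented by an actual quasi-isomorphism ([perfect_quasi_iso]). *)

(** * Noetherian spectra *)

Section NoetherianSpectrum.
Variable R : comPzRingType.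
Implicit Types (K : set R) (p : Spec R).

Definition mult_closed (S : set R) : Prop :=
  S 1 /\ forall x y, S x -> S y -> S (x * y).

Lemma mult_closed_prime p : mult_closed (~` (p : set R)).
Proof. by split=> [|x y px py /spec_prime[]//]; exact: spec_proper. Qed.

Lemma mult_closed1 : mult_closed [set (1 : R)].
Proof. by split=> // x y -> ->; rewrite mulr1. Qed.

Lemma ideal_sum K (n : nat) (F : nat -> R) :
  is_ideal K -> (forall i, (i < n)%N -> K (F i)) -> K (\sum_(i < n) F i).
Proof.
move=> iK KF; apply: big_ind => [|x y|i _]; first exact: ideal0.
  exact: idealD.
exact: KF.
Qed.

Definition adjoin K (x : R) : set R :=
  [set y | exists2 k, K k & exists r, y = k + r * x].

Lemma adjoin_ideal K x : is_ideal K -> is_ideal (adjoin K x).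
Proof.
move=> iK; split.
- by exists 0; [exact: ideal0|exists 0; rewrite mul0r addr0].
- move=> _ _ [k Kk [r ->]] [l Kl [s ->]]; exists (k + l); first exact: idealD.
  by exists (r + s); ring.
- move=> a _ [k Kk [r ->]]; exists (a * k); first exact: idealM.
  by exists (a * r); ring.
Qed.

Lemma sub_adjoin K x : K `<=` adjoin K x.
Proof. by move=> k Kk; exists k => //; exists 0; rewrite mul0r addr0. Qed.

Lemma adjoin_self K x : is_ideal K -> adjoin K x x.
Proof.
by move=> iK; exists 0; [exact: ideal0|exists 1; rewrite mul1r add0r].
Qed.

Lemma adjoin_mul K x y u v : is_ideal K -> K (x * y) ->
  adjoin K x u -> adjoin K y v -> K (u * v).
Proof.
move=> iK Kxy [k Kk [r ->]] [l Kl [s ->]].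
have -> : (k + r * x) * (l + s * y) = (l + s * y) * k + (r * x) * l
  + (r * s) * (x * y) by ring.
by do 2?[apply: (idealD iK)]; apply: (idealM iK).
Qed.

Hypothesis hR : noetherian R.

(** The union of a strictly increasing chain of counterexamples would be a
finitely generated ideal, whose generators all lie in one member of the
chain. *)
Lemma noetherian_ind (Phi : set R -> Prop) :
  (forall K, is_ideal K ->
     (forall L, is_ideal L -> K `<=` L -> ~ (L `<=` K) -> Phi L) -> Phi K) ->
  forall K, is_ideal K -> Phi K.
Proof.
move=> IH K0 iK0; apply: contrapT => nK0.
pose bad := {K : set R | is_ideal K /\ ~ Phi K}.
have /choice[next nextP] : forall B : bad, exists C : bad,
    sval B `<=` sval C /\ ~ (sval C `<=` sval B).
  move=> [K [iK nK]] /=; apply: contrapT => nC; apply/nK/IH => // L iL KL nLK.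
  apply: contrapT => nL; apply: nC.
  by exists (exist _ L (conj iL nL)).
pose C n := sval (iter n next (exist _ K0 (conj iK0 nK0) : bad)).
have iC n : is_ideal (C n) by rewrite /C; case: (iter _ _ _) => ? [].
have Cmono m n : (m <= n)%N -> C m `<=` C n.
  elim: n => [|n ihn]; first by rewrite leqn0 => /eqP ->.
  rewrite leq_eqVlt => /orP[/eqP-> //|/ihn/subset_trans]; apply.
  exact: (nextP _).1.
have [s sE] : exists s : seq R, \bigcup_n C n =
    [set x | exists c : nat -> R, x = \sum_(i < size s) c i * s`_i].
  apply: hR; split; first by exists 0%N => //; exact: ideal0.
    move=> x y [m _ Cx] [n _ Cy]; exists (maxn m n) => //.
    by apply: (idealD (iC _)); [move: Cx|move: Cy]; apply: Cmono;
       rewrite ?leq_maxl ?leq_maxr.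
  by move=> a x [n _ Cx]; exists n => //; exact: idealM.
have [N CN] : exists N, forall i, (i < size s)%N -> C N s`_i.
  have [f fP] : exists f : nat -> nat, forall i, (i < size s)%N -> C (f i) s`_i.
    suff /choice[f fP] : forall i, exists n, (i < size s)%N -> C n s`_i by exists f.
    move=> i; case: (ltnP i (size s)) => [i_s|]; last by exists 0%N.
    suff [n _] : (\bigcup_n C n) s`_i by exists n.
    rewrite sE; exists (fun j => (j == i)%:R).
    rewrite (bigD1 (Ordinal i_s)) //= eqxx mul1r big1 ?addr0 // => j /eqP ji.
    by case: eqP => [e|_]; [case: ji; apply: val_inj|rewrite mul0r].
  exists (\max_(i < size s) f i)%N => i i_s.
  by move: (fP i i_s); apply: Cmono; exact: (leq_bigmax (Ordinal i_s)).
apply: (nextP (iter N next (exist _ K0 (conj iK0 nK0)))).2 => x Cx.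
have : (\bigcup_n C n) x by exists N.+1.
rewrite sE => -[c ->]; apply: (ideal_sum (F := fun i => c i * s`_i)); first exact: (iC N).
by move=> i i_s; apply: (idealM (iC N)); exact: CN.
Qed.

(** An ideal that is neither prime nor the whole ring contains a product xy
with neither x nor y in it, so a property that descends from K + (x) and
K + (y) to K need only be checked for primes. This replaces primary
decomposition and finiteness of the set of minimal primes. *)
Lemma prime_ind (Phi : set R -> Prop) :
  Phi setT -> (forall p, Phi p) ->
  (forall K x y, is_ideal K -> K (x * y) ->
     Phi (adjoin K x) -> Phi (adjoin K y) -> Phi K) ->
  forall K, is_ideal K -> Phi K.
Proof.
move=> PhiT Phip Phi2; apply: noetherian_ind => K iK IH.
have [K1|nK1] := pselect (K 1).
  suff -> : K = setT by [].
  by apply/seteqP; split=> // x _; rewrite -[x]mulr1; exact: idealM.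
have [prK|] := pselect (forall x y, K (x * y) -> K x \/ K y).
  exact: (Phip (MkSpec iK nK1 prK)).
rewrite -existsNE => -[x]; rewrite -existsNE => -[y].
rewrite not_implyE not_orE => -[Kxy [nKx nKy]].
apply: (Phi2 K x y) => //; apply: IH.
- exact: adjoin_ideal.
- exact: sub_adjoin.
- by move/(_ _ (adjoin_self x iK)).
- exact: adjoin_ideal.
- exact: sub_adjoin.
- by move/(_ _ (adjoin_self y iK)).
Qed.

Lemma ideal_unit_or_prime K : is_ideal K ->
  (forall p, exists2 t, K t & ~ spec_set p t) -> K 1.
Proof.
move=> iK; apply: contrapT.
suff [/[swap]//|[p Kp]] : K 1 \/ exists p, K `<=` p.
  by move=> h; apply: h => /(_ p)[t /Kp].
move: K iK; apply: prime_ind => [|p|K x y iK Kxy]; first by left.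
  by right; exists p.
move=> [x1|[p Kp] _]; last by right; exists p => k /(@sub_adjoin _ x)/Kp.
move=> [y1|[p Kp]]; last by right; exists p => k /(@sub_adjoin _ y)/Kp.
by left; rewrite -[1]mulr1; exact: (adjoin_mul iK Kxy x1 y1).
Qed.

Lemma radical_exponent (c : R) K : is_ideal K ->
  (forall p, K `<=` p -> spec_set p c) -> exists n, K (c ^+ n).
Proof.
move: K; apply: prime_ind => [|p cp|K x y iK Kxy IHx IHy cK].
- by exists 0%N.
- by exists 1%N; exact: cp.
have [|m xm] := IHx; first by move=> p Kp; apply: cK => k /(@sub_adjoin _ x)/Kp.
have [|n yn] := IHy; first by move=> p Kp; apply: cK => k /(@sub_adjoin _ y)/Kp.
by exists (m + n)%N; rewrite exprD; exact: (adjoin_mul iK Kxy xm yn).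
Qed.

Definition zeros K : set (Spec R) := [set p | K `<=` p].

Lemma thick_specialize (S : set (Spec R)) p p' :
  thick_support S -> S p -> (p : set R) `<=` p' -> S p'.
Proof.
move=> [F Fcl ->] [C FC Cp] pp'; exists C => //.
have [I iI CE] := Fcl _ FC; move: Cp; rewrite CE => Ip.
exact: subset_trans pp'.
Qed.

Lemma closed_thick (S : set (Spec R)) : zariski_closed S -> thick_support S.
Proof.
move=> cS; exists [set S]; first by move=> _ ->.
by rewrite bigcup_set1.
Qed.

Lemma zeros_adjoin K x y : is_ideal K -> K (x * y) ->
  zeros K = zeros (adjoin K x) `|` zeros (adjoin K y).
Proof.
move=> iK Kxy; apply/seteqP; split=> [p Kp|p [] h k /sub_adjoin/h//].
have [px|py] := spec_prime (Kp _ Kxy); [left|right] => _ [k Kk [r ->]].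
  by apply: (idealD (spec_ideal p)); [exact: Kp|exact: (idealM (spec_ideal p))].
by apply: (idealD (spec_ideal p)); [exact: Kp|exact: (idealM (spec_ideal p))].
Qed.

Lemma zariski_closedU (C D : set (Spec R)) :
  zariski_closed C -> zariski_closed D -> zariski_closed (C `|` D).
Proof.
move=> [I iI ->] [J iJ ->]; exists (I `&` J).
  split; first by split; exact: ideal0.
    by move=> x y [Ix Jx] [Iy Jy]; split; exact: idealD.
  by move=> a x [Ix Jx]; split; exact: idealM.
apply/seteqP; split=> p /=; first by case=> h k [Ik Jk]; exact: h.
move=> IJp; apply: contrapT; rewrite not_orE => -[].
rewrite -!existsNE => -[x]; rewrite not_implyE => -[Ix npx] [y].
rewrite not_implyE => -[Jy npy].
have /IJp/spec_prime[] // : (I `&` J) (x * y).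
by split; [rewrite mulrC|]; exact: idealM.
Qed.

(** For K prime, the generic point of V(K) lies in one of the two pieces, which
then contains all of V(K). *)
Lemma thick_piece_closed (S : bool -> set (Spec R)) (b : bool) K :
  (forall b, thick_support (S b)) -> trivIset setT S ->
  is_ideal K -> zeros K `<=` \bigcup_b S b -> zariski_closed (S b `&` zeros K).
Proof.
move=> tS dS; move: K; apply: prime_ind => [|p|K x y iK Kxy IHx IHy] KS.
- exists setT; first by split.
  by apply: setIidr => q /(_ 1 I)/spec_proper.
- have [|b' _ pb'] := KS p; first by [].
  have pS : zeros p `<=` S b' by move=> q; exact: thick_specialize.
  have [->|nb] := eqVneq b b'.
    exists p; first exact: spec_ideal.
    by apply: setIidr.
  exists setT; first by split.
  apply/seteqP; split=> q; last by move=> /(_ 1 I)/spec_proper.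
  by move=> [qb /pS qb']; case/eqP: nb; apply: (dS _ _ I I); exists q.
- rewrite (zeros_adjoin iK Kxy) setIUr.
  by apply: zariski_closedU; [apply: IHx|apply: IHy] => q qK; apply: KS;
     rewrite (zeros_adjoin iK Kxy); [left|right].
Qed.

(** The ideals of the two pieces have no common prime, so they contain a and b
with a + b = 1; the product ab vanishes on all of V(K), hence is nilpotent
modulo K. *)
Lemma separate_closed (S : bool -> set (Spec R)) K :
  (forall b, thick_support (S b)) -> trivIset setT S -> is_ideal K ->
  zeros K = \bigcup_b S b ->
  exists e : bool -> R, [/\ e true + e false = 1,
    (forall b p, S b p -> spec_set p (e b)) & exists n, K ((e true * e false) ^+ n)].
Proof.
move=> tS dS iK KS.
have cS b : zariski_closed (S b).
  have -> : S b = S b `&` zeros K.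
    by apply/esym/setIidl => p Sp; rewrite KS; exists b.
  by apply: thick_piece_closed => //; rewrite KS.
have /choice[J JP] : forall b, exists J, is_ideal J /\ S b = zeros J.
  by move=> b; have [J iJ ->] := cS b; exists J.
have iJ b := (JP b).1; have SJ b := (JP b).2.
pose J2 : set R := [set x | exists a b, [/\ J true a, J false b & x = a + b]].
have iJ2 : is_ideal J2.
  split; first by exists 0, 0; split; [exact: ideal0|exact: ideal0|rewrite addr0].
    move=> _ _ [a [b [Ja Jb ->]]] [a' [b' [Ja' Jb' ->]]].
    by exists (a + a'), (b + b'); split; [exact: idealD|exact: idealD|ring].
  move=> r _ [a [b [Ja Jb ->]]].
  by exists (r * a), (r * b); split; [exact: idealM|exact: idealM|ring].
have [] : J2 1.
  apply: ideal_unit_or_prime => // p; apply: contrapT => np.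
  have Jp b : S b p.
    rewrite SJ => x Jx; apply: contrapT => npx; apply: np; exists x => //.
    by case: b Jx => Jx; [exists x, 0; rewrite addr0|exists 0, x; rewrite add0r];
      split=> //; exact: ideal0.
  by have /eqP : true = false by apply: (dS _ _ I I); exists p.
move=> a [b [Ja Jb ab1]]; exists (fun c => if c then a else b); split.
- by rewrite ab1.
- by case=> p; rewrite SJ; exact.
apply: radical_exponent => // p; rewrite -[_ `<=` _]/(zeros K p) KS.
move=> [[] _]; rewrite SJ => Jp; last exact: (idealM (spec_ideal p) a (Jp _ Jb)).
by rewrite mulrC; exact: (idealM (spec_ideal p) b (Jp _ Ja)).
Qed.

End NoetherianSpectrum.

Section IndecomposableSets.
Variable R : comPzRingType.
Implicit Types S T : set (Spec R).

Lemma thick_supportP S : thick_support S <->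
  forall p p' : Spec R, S p -> (p : set R) `<=` p' -> S p'.
Proof.
split=> [tS p p'|spS]; first exact: thick_specialize.
exists [set C | exists2 p, S p & C = zeros p].
  by move=> _ [p _ ->]; exists p => //; exact: spec_ideal.
apply/seteqP; split=> [p Sp|p' [_ [p Sp ->] pp']]; last exact: spS Sp pp'.
by exists (zeros p) => //; exists p.
Qed.

(** If S met a second T_ j', then T_ j and the complement of T_ j would cut S
into two thick supports: inside S, the complement of T_ j is covered by the
other T_ j' and is therefore closed under specialisation. *)
Lemma indecomposable_sub (J : Type) S (T_ : J -> set (Spec R)) :
  indecomposable S -> (forall j, thick_support (T_ j)) -> trivIset setT T_ ->
  S `<=` \bigcup_j T_ j -> exists j, S `<=` T_ j.
Proof.
move=> [tS [p Sp] nS] tT dT ST; have [j _ Tp] := ST p Sp; exists j.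
move=> q Sq; apply: contrapT => nTq; apply: nS.
exists (fun b => if b then S `&` T_ j else S `\` T_ j); split; last first.
  by case; [exists p|exists q].
split.
- case; apply/thick_supportP => r r' [Sr Tr] rr'; split;
    try exact: thick_specialize tS Sr rr'; first exact: thick_specialize (tT j) Tr rr'.
  move=> Tr'; apply: Tr; have [j' _ Tr] := ST r Sr.
  suff -> : j = j' by [].
  by apply: (dT j j' Logic.I Logic.I); exists r'; split=> //; exact: thick_specialize (tT j') Tr rr'.
- by move=> [] [] _ _ [r [[_ Tr] [_ Tr']]].
- apply/seteqP; split=> [r Sr|r [[] _ []//]].
  by have [Tr|nTr] := pselect (T_ j r); [exists true|exists false].
Qed.

Lemma indecomposable_match (I J : Type) (S_ : I -> set (Spec R))
    (T_ : J -> set (Spec R)) :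
  (forall i, indecomposable (S_ i)) -> (forall j, indecomposable (T_ j)) ->
  trivIset setT S_ -> trivIset setT T_ -> \bigcup_i S_ i = \bigcup_j T_ j ->
  exists2 sigma : I -> J, bijective sigma & forall i, S_ i = T_ (sigma i).
Proof.
move=> iS iT dS dT ST.
have tS i : thick_support (S_ i) by have [] := iS i.
have tT j : thick_support (T_ j) by have [] := iT j.
have /choice[sigma sigmaP] : forall i, exists j, S_ i `<=` T_ j.
  move=> i; apply: (indecomposable_sub (iS i) tT dT); rewrite -ST.
  exact: bigcup_sup.
have /choice[tau tauP] : forall j, exists i, T_ j `<=` S_ i.
  move=> j; apply: (indecomposable_sub (iT j) tS dS); rewrite ST.
  exact: bigcup_sup.
have sigmaK : cancel sigma tau.
  move=> i; have [_ [p Sp] _] := iS i; apply: (dS _ _ Logic.I Logic.I); exists p; split=> //.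
  by apply: tauP; exact: sigmaP.
exists sigma.
  exists tau => // j; have [_ [p Tp] _] := iT j; apply: (dT _ _ Logic.I Logic.I).
  by exists p; split=> //; apply: sigmaP; exact: tauP.
by move=> i; apply/seteqP; split=> // p /tauP; rewrite sigmaK.
Qed.

End IndecomposableSets.

(** From au + bv = 1 to the next power: expanding (au + bv)^3 = 1 and grouping
the terms gives new multiples of a and b with sum 1 whose product is divisible
by (au bv)^2. *)
Lemma coprime_power (R : comPzRingType) (a b : R) (n : nat) : a + b = 1 ->
  exists u v w, a * u + b * v = 1 /\ (a * u) * (b * v) = (a * b) ^+ n.+1 * w.
Proof.
move=> ab1; elim: n => [|n [u [v [w [uv1 uvw]]]]].
  by exists 1, 1, 1; rewrite !mulr1 expr1.
exists (a * u ^+ 2 * (a * u + 3 * (b * v))), (b * v ^+ 2 * (3 * (a * u) + b * v)).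
exists (w * u * v * (a * u + 3 * (b * v)) * (3 * (a * u) + b * v)); split.
  by transitivity ((a * u + b * v) ^+ 3); [ring|rewrite uv1 expr1n].
transitivity ((a * u * (b * v)) * (a * b)
  * (u * v * (a * u + 3 * (b * v)) * (3 * (a * u) + b * v))).
  by ring.
by rewrite uvw [_ ^+ n.+2]exprSr; move: (_ ^+ n.+1) => c; ring.
Qed.

(** * Modules *)

Section LinearImage.
Variables (R : comPzRingType) (M N : lmodType R) (f : {linear M -> N}).

(** The image of [f] as a module in its own right; it serves to lift along maps
that are not surjective, and to form the summand cut out by an idempotent. *)
Record limage : Type := LImage { lval :> N; lvalP : exists x, f x = lval }.

HB.instance Definition _ := gen_eqMixin limage.
HB.instance Definition _ := gen_choiceMixin limage.

Lemma lval_inj : injective lval.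
Proof.
by move=> [x px] [y py] /= e; subst y; congr LImage; exact: Prop_irrelevance.
Qed.

Lemma limage0_subproof : exists x, f x = 0.
Proof. by exists 0; rewrite linear0. Qed.
Lemma limageD_subproof (x y : limage) : exists z, f z = lval x + lval y.
Proof.
have [u ux] := lvalP x; have [v vy] := lvalP y.
by exists (u + v); rewrite linearD ux vy.
Qed.
Lemma limageZ_subproof a (x : limage) : exists z, f z = a *: lval x.
Proof. by have [u ux] := lvalP x; exists (a *: u); rewrite linearZ ux. Qed.

Definition limage0 := LImage limage0_subproof.
Definition limageD x y := LImage (limageD_subproof x y).
Definition limageZ a x := LImage (limageZ_subproof a x).
Definition limageN x := limageZ (- 1) x.

Lemma limageA : associative limageD.
Proof. by move=> x y z; apply: lval_inj; rewrite /= addrA. Qed.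
Lemma limageC : commutative limageD.
Proof. by move=> x y; apply: lval_inj; rewrite /= addrC. Qed.
Lemma limage0D : left_id limage0 limageD.
Proof. by move=> x; apply: lval_inj; rewrite /= add0r. Qed.
Lemma limageND : left_inverse limage0 limageN limageD.
Proof. by move=> x; apply: lval_inj; rewrite /= scaleN1r addNr. Qed.
HB.instance Definition _ :=
  GRing.isZmodule.Build limage limageA limageC limage0D limageND.

Lemma limageZA a b x : limageZ a (limageZ b x) = limageZ (a * b) x.
Proof. by apply: lval_inj; rewrite /= scalerA. Qed.
Lemma limage1Z : left_id 1 limageZ.
Proof. by move=> x; apply: lval_inj; rewrite /= scale1r. Qed.
Lemma limageZDr : right_distributive limageZ +%R.
Proof. by move=> a x y; apply: lval_inj; rewrite /= scalerDr. Qed.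
Lemma limageZDl x : {morph limageZ^~ x : a b / a + b}.
Proof. by move=> a b; apply: lval_inj; rewrite /= scalerDl. Qed.
HB.instance Definition _ := GRing.Zmodule_isLmodule.Build R limage
  limageZA limage1Z limageZDr limageZDl.

Lemma lval_linear : linear lval. Proof. by []. Qed.
HB.instance Definition _ :=
  GRing.isLinear.Build R limage N *:%R lval lval_linear.

Section Corestriction.
Variables (L : lmodType R) (g : {linear L -> N}) (gf : forall x, exists y, f y = g x).
Definition colimage (x : L) : limage := LImage (gf x).
Lemma colimage_linear : linear colimage.
Proof. by move=> a x y; apply: lval_inj; rewrite /= linearP. Qed.
HB.instance Definition _ :=
  GRing.isLinear.Build R L limage *:%R colimage colimage_linear.
End Corestriction.

End LinearImage.

Section ProjectiveModules.
Variable R : comPzRingType.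

Lemma projective_lift (P M N : lmodType R) (g : {linear M -> N})
    (f : {linear P -> N}) :
  projective P -> (forall x, exists y, g y = f x) ->
  exists h : {linear P -> M}, forall x, g (h x) = f x.
Proof.
move=> prP fg.
have gg x : exists y, g y = g x by exists x.
have [|h hP] := prP _ _ (colimage gg : {linear _ -> _}) (colimage fg : {linear _ -> _}).
  by move=> y; have [x xy] := lvalP y; exists x; apply: lval_inj.
by exists h => x; have /(congr1 (@lval _ _ _ _)) := hP x.
Qed.

Lemma projective_retract (P Q : lmodType R) (i : {linear P -> Q})
    (r : {linear Q -> P}) :
  cancel i r -> projective Q -> projective P.
Proof.
move=> ir prQ M N g f gs.
have [h hP] := prQ M N g (f \o r : {linear _ -> _}) gs.
by exists (h \o i : {linear _ -> _}) => x /=; rewrite hP /= ir.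
Qed.

Definition lin_span (M : lmodType R) (s : seq M) : set M :=
  [set x | exists c : nat -> R, x = \sum_(i < size s) c i *: s`_i].

Lemma lin_span_cat (M : lmodType R) (s t : seq M) x y :
  lin_span s x -> lin_span t y -> lin_span (s ++ t) (x + y).
Proof.
move=> [c ->] [d ->].
exists (fun i => if (i < size s)%N then c i else d (i - size s)%N).
rewrite size_cat big_split_ord /=; congr (_ + _).
  by apply: eq_bigr => i _; rewrite nth_cat ltn_ord.
by apply: eq_bigr => i _; rewrite nth_cat ltnNge leq_addr /= addKn.
Qed.

Lemma lin_span_map (M N : lmodType R) (f : {linear M -> N}) (s : seq M) x :
  lin_span s x -> lin_span (map f s) (f x).
Proof.
move=> [c ->]; exists c; rewrite size_map linear_sum; apply: eq_bigr => i _.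
by rewrite linearZ (nth_map 0).
Qed.

Lemma fin_gen_surj (M N : lmodType R) (f : {linear M -> N}) :
  (forall y, exists x, f x = y) -> fin_gen M -> fin_gen N.
Proof.
by move=> fs [s sP]; exists (map f s) => y; have [x <-] := fs y; exact: lin_span_map.
Qed.

End ProjectiveModules.

Section DsumStructure.
Variables (R : comPzRingType) (I : Type) (M : I -> lmodType R).

Definition dproj i (x : dsum M) : M i := x i.
Lemma dproj_linear i : linear (@dproj i). Proof. by []. Qed.
HB.instance Definition _ i :=
  GRing.isLinear.Build R (dsum M) (M i) *:%R (@dproj i) (@dproj_linear i).

(** [I] has no decidable equality, hence the classical test and the transport
along the equation it provides. *)
Definition din_fun i (m : M i) j : M j :=
  if pselect (i = j) is left e then eq_rect i (fun k => M k : Type) m j e else 0.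

Lemma din_fun_in i (m : M i) : din_fun m i = m.
Proof.
by rewrite /din_fun; case: pselect => [e|//]; rewrite (Prop_irrelevance e erefl).
Qed.

Lemma din_fun_out i (m : M i) j : i <> j -> din_fun m j = 0.
Proof. by rewrite /din_fun; case: pselect. Qed.

Lemma din_subproof i (m : M i) : finite_set [set j | din_fun m j != 0].
Proof.
apply: (sub_finite_set _ (finite_set1 i)) => j /= /eqP mj.
by apply: contrapT => ji; apply: mj; rewrite din_fun_out // => ij; apply: ji.
Qed.

Definition din i (m : M i) : dsum M := Dsum (din_subproof m).

Lemma din_in i (m : M i) : din m i = m. Proof. exact: din_fun_in. Qed.
Lemma din_out i (m : M i) j : i <> j -> din m j = 0.
Proof. exact: din_fun_out. Qed.

Lemma din_linear i : linear (@din i).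
Proof.
move=> a x y; apply: dsum_ext => j /=.
have [ij|ij] := pselect (i = j); first by subst j; rewrite !din_fun_in.
by rewrite !din_fun_out // scaler0 addr0.
Qed.
HB.instance Definition _ i :=
  GRing.isLinear.Build R (M i) (dsum M) *:%R (@din i) (@din_linear i).

Lemma dproj_sum (J : Type) (r : seq J) (F : J -> dsum M) i :
  (\sum_(j <- r) F j) i = \sum_(j <- r) F j i.
Proof. exact: (linear_sum (@dproj i)). Qed.

End DsumStructure.

Section DsumProjective.
Variables (R : comPzRingType) (I : eqType) (M : I -> lmodType R) (s : seq I).
Hypotheses (us : uniq s) (Ms : forall i (m : M i), i \notin s -> m = 0).

Lemma dsum_decomp (x : dsum M) : x = \sum_(i <- s) din (x i).
Proof.
apply: dsum_ext => j; rewrite dproj_sum; case: (boolP (j \in s)) => js.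
  rewrite (bigD1_seq j) //= din_fun_in big1 ?addr0 // => i /eqP ij.
  by rewrite din_fun_out.
by rewrite [LHS]Ms // [RHS]Ms.
Qed.

Lemma dsum_projective : (forall i, projective (M i)) -> projective (dsum M).
Proof.
move=> prM A B g f gs.
have H i : exists h : {linear M i -> A}, forall x, g (h x) = f (din x).
  exact: (prM i _ _ g (f \o @din _ _ _ i : {linear _ -> _}) gs).
pose h i := projT1 (cid (H i)).
have hP i x : g (h i x) = f (din x) by rewrite /h; case: cid.
pose k (x : dsum M) := \sum_(i <- s) h i (x i).
have k_lin : linear k.
  move=> a x y; rewrite /k scaler_sumr -big_split; apply: eq_bigr => i _.
  exact: (linearP (h i)).
pose kl := GRing.isLinear.Build R (dsum M) A *:%R k k_lin.
exists (HB.pack_for {linear dsum M -> A} k kl) => x /=.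
rewrite /k linear_sum [x in RHS]dsum_decomp linear_sum.
by apply: eq_bigr => i _; rewrite hP.
Qed.

Lemma dsum_fin_gen : (forall i, fin_gen (M i)) -> fin_gen (dsum M).
Proof.
move=> fgM; pose gens i := projT1 (cid (fgM i)).
have gensP i x : lin_span (gens i) x by rewrite /gens; case: cid => t tP; exact: tP.
exists (flatten [seq map (@din _ _ M i) (gens i) | i <- s]) => x.
rewrite [x]dsum_decomp; elim: s => [|i r IH] /=.
  by exists (fun=> 0); rewrite big_nil big_ord0.
by rewrite big_cons; apply: lin_span_cat => //; exact: lin_span_map.
Qed.

End DsumProjective.

(** * Cohomology and isomorphism in the derived category *)

(** Packs a function with a proof of its linearity, for maps that are built
inside proofs. *)
Definition lin_of (R : comPzRingType) (U V : lmodType R) (f : U -> V)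
    (fL : linear f) : {linear U -> V} :=
  HB.pack_for {linear U -> V} f (GRing.isLinear.Build R U V *:%R f fL).

Lemma int_succ_ind (Q : int -> Prop) : (forall n, Q (n + 1)) -> forall n, Q n.
Proof. by move=> Qs n; rewrite -(subrK 1 n). Qed.

Section Cohomology.
Variable R : comPzRingType.
Implicit Types (X Y Z : complex R) (n : int).

(** Degrees are written n + 1 because the differential into degree n + 1 starts
at n; [int_succ_ind] shows that this is no restriction. *)
Definition coboundary X n (x : X (n + 1)) : Prop := exists y, x = diff X n y.

Lemma coboundary0 X n : coboundary (0 : X (n + 1)).
Proof. by exists 0; rewrite linear0. Qed.

Lemma coboundaryD X n (x y : X (n + 1)) :
  coboundary x -> coboundary y -> coboundary (x + y).
Proof. by move=> [u ->] [v ->]; exists (u + v); rewrite linearD. Qed.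

Lemma coboundaryZ X n a (x : X (n + 1)) : coboundary x -> coboundary (a *: x).
Proof. by move=> [u ->]; exists (a *: u); rewrite linearZ. Qed.

Lemma coboundaryN X n (x : X (n + 1)) : coboundary x -> coboundary (- x).
Proof. by move=> xb; rewrite -scaleN1r; exact: coboundaryZ. Qed.

Lemma coboundaryB X n (x y : X (n + 1)) :
  coboundary x -> coboundary y -> coboundary (x - y).
Proof. by move=> xb yb; apply: coboundaryD => //; exact: coboundaryN. Qed.

Lemma coboundary_sub X n (x y : X (n + 1)) :
  coboundary (x - y) -> coboundary y -> coboundary x.
Proof. by move=> xy yb; rewrite -(subrK y x); exact: coboundaryD. Qed.

Lemma coboundary_diff X n (y : X n) : coboundary (diff X n y).
Proof. by exists y. Qed.

Lemma coboundary_cmap X Y (f : cmap X Y) n (x : X (n + 1)) :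
  coboundary x -> coboundary (f (n + 1) x).
Proof. by move=> [u ->]; exists (f n u); rewrite cfun_diff. Qed.

Lemma cocycle_cmap X Y (f : cmap X Y) n (x : X n) :
  diff X n x = 0 -> diff Y n (f n x) = 0.
Proof. by move=> dx; rewrite -cfun_diff dx linear0. Qed.

Definition coh_inj X Y (f : cmap X Y) : Prop := forall n (x : X (n + 1)),
  diff X (n + 1) x = 0 -> coboundary (f (n + 1) x) -> coboundary x.

Definition coh_surj X Y (f : cmap X Y) : Prop := forall n (y : Y (n + 1)),
  diff Y (n + 1) y = 0 ->
  exists2 x : X (n + 1), diff X (n + 1) x = 0 & coboundary (y - f (n + 1) x).

Lemma quasi_isoP X Y (f : cmap X Y) : quasi_iso f <-> coh_inj f /\ coh_surj f.
Proof.
split=> [qf|[fi fs] n]; last by split; [exact: fi|exact: fs].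
by split=> n; have [fi fs] := qf n; [exact: fi|exact: fs].
Qed.

Lemma coh_inj_comp X Y Z (g : cmap Y Z) (f : cmap X Y) :
  coh_inj (cmap_comp g f) -> coh_inj f.
Proof. by move=> gfi n x dx fx; apply: gfi => //=; exact: coboundary_cmap. Qed.

Lemma coh_surj_comp X Y Z (g : cmap Y Z) (f : cmap X Y) :
  coh_surj (cmap_comp g f) -> coh_surj g.
Proof.
move=> gfs n z /gfs[x dx xz]; exists (f (n + 1) x) => //.
exact: cocycle_cmap.
Qed.

Lemma coh_inj_comp_surj X Y Z (g : cmap Y Z) (f : cmap X Y) :
  coh_inj (cmap_comp g f) -> coh_surj f -> coh_inj g.
Proof.
move=> gfi fs n y dy gy; have [x dx yx] := fs n y dy.
apply: (coboundary_sub yx); apply: coboundary_cmap; apply: gfi => //=.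
rewrite -[g _ _](subKr (g (n + 1) y)) -linearB.
by apply: coboundaryB => //; exact: coboundary_cmap.
Qed.

Lemma coh_surj_comp_inj X Y Z (g : cmap Y Z) (f : cmap X Y) :
  coh_surj (cmap_comp g f) -> coh_inj g -> coh_surj f.
Proof.
move=> gfs gi n y dy; have [|x dx yx] := gfs n (g (n + 1) y).
  exact: cocycle_cmap.
exists x => //; apply: gi; last by rewrite linearB.
by rewrite linearB dy cocycle_cmap // subr0.
Qed.

Lemma coh_homotopic X Y (f g : cmap X Y) n (x : X (n + 1)) :
  homotopic f g -> diff X (n + 1) x = 0 -> coboundary (f (n + 1) x - g (n + 1) x).
Proof.
by move=> [h hP] dx; rewrite hP dx linear0 addr0; exact: coboundary_diff.
Qed.

Lemma homotopic_sym X Y (f g : cmap X Y) : homotopic f g -> homotopic g f.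
Proof.
move=> [h hP].
have hL n : linear (fun x => - h n x).
  by move=> a x y; rewrite linearP opprD scalerN.
by exists (fun n => lin_of (hL n)) => n x /=; rewrite linearN -opprD -hP opprB.
Qed.

Lemma homotopic_refl X Y (f : cmap X Y) : homotopic f f.
Proof. by exists (fun n => \0) => n x; rewrite subrr linear0 addr0. Qed.

Lemma quasi_iso_homotopic X Y (f g : cmap X Y) :
  homotopic f g -> quasi_iso f -> quasi_iso g.
Proof.
move=> fg /quasi_isoP[fi fs]; apply/quasi_isoP; split=> n.
  move=> x dx gx; apply: fi => //.
  by apply: coboundary_sub gx; exact: coh_homotopic.
move=> y dy; have [x dx yx] := fs n y dy; exists x => //.
rewrite -(subrK (f (n + 1) x) y) -addrA.
by apply: coboundaryD => //; exact: coh_homotopic.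
Qed.

Lemma quasi_iso_cancel_left X Y Z (g : cmap Y Z) (f : cmap X Y) :
  quasi_iso (cmap_comp g f) -> quasi_iso g -> quasi_iso f.
Proof.
move=> /quasi_isoP[gfi gfs] /quasi_isoP[gi gs]; apply/quasi_isoP; split.
  exact: coh_inj_comp gfi.
exact: coh_surj_comp_inj gfs gi.
Qed.

Lemma quasi_iso_cancel_right X Y Z (g : cmap Y Z) (f : cmap X Y) :
  quasi_iso (cmap_comp g f) -> quasi_iso f -> quasi_iso g.
Proof.
move=> /quasi_isoP[gfi gfs] /quasi_isoP[fi fs]; apply/quasi_isoP; split.
  exact: coh_inj_comp_surj gfi fs.
exact: coh_surj_comp gfs.
Qed.

(** Half of the proof that an invertible roof has a quasi-isomorphism for right
leg: in cohomology the left legs are invertible, so r ; s = id makes the right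
leg of s surjective and that of r injective. *)
Lemma roof_comp_id_surj X Y (r : roof X Y) (s : roof Y X) :
  roof_comp r s (roof_id X) -> coh_surj (rleg s) /\ coh_inj (rleg r).
Proof.
move=> [V [u [v [qu [ruv [V' [u' [v' [/= qu' e1 e2]]]]]]]]].
have qv' : quasi_iso v'.
  apply: quasi_iso_cancel_left (quasi_iso_comp qu (lleg_qis r)).
  exact: quasi_iso_homotopic e1 qu'.
have qsv : quasi_iso (cmap_comp (rleg s) v).
  by apply: quasi_iso_cancel_right qv'; exact: quasi_iso_homotopic e2 qu'.
have [/coh_inj_comp vi /coh_surj_comp ss] := (quasi_isoP _).1 qsv.
split=> //; have [_ us] := (quasi_isoP _).1 qu.
apply: (coh_inj_comp_surj _ us) => n x dx rux.
apply: vi => //; have [si _] := (quasi_isoP _).1 (lleg_qis s).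
apply: si; first exact: cocycle_cmap.
exact: coboundary_sub (coh_homotopic (homotopic_sym ruv) dx) rux.
Qed.

(** Isomorphism in the derived category is the existence of a span of
quasi-isomorphisms; all later arguments use spans only. *)
Lemma D_isoP X Y : D_iso X Y <->
  exists (A : complex R) (l : cmap A X) (r : cmap A Y), quasi_iso l /\ quasi_iso r.
Proof.
split=> [[r [s [rs sr]]]|[A [l [r [ql qr]]]]].
  exists (apex r), (lleg r), (rleg r); split; first exact: lleg_qis.
  apply/quasi_isoP; split; first by have [] := roof_comp_id_surj rs.
  by have [] := roof_comp_id_surj sr.
exists (Roof r ql), (Roof l qr); split.
  exists A, (cmap_id A), (cmap_id A), (@quasi_iso_id _ A); split.
    exact: homotopic_refl.
  exists A, l, (cmap_id A); split; [exact: ql|exact: homotopic_refl|].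
  exact: homotopic_refl.
exists A, (cmap_id A), (cmap_id A), (@quasi_iso_id _ A); split.
  exact: homotopic_refl.
exists A, r, (cmap_id A); split; [exact: qr|exact: homotopic_refl|].
exact: homotopic_refl.
Qed.

Lemma D_iso_quasi_iso X Y (f : cmap X Y) : quasi_iso f -> D_iso X Y.
Proof.
move=> qf; apply/D_isoP; exists X, (cmap_id X), f.
by split=> //; exact: quasi_iso_id.
Qed.

Definition acyclic X : Prop :=
  forall n (x : X (n + 1)), diff X (n + 1) x = 0 -> coboundary x.

Lemma D_iso_zeroP X : D_iso X (zero_cpx R) <-> acyclic X.
Proof.
split=> [/D_isoP[A [l [r [ql qr]]]] n x dx|aX].
  have [ri _] := (quasi_isoP _).1 qr; have [_ ls] := (quasi_isoP _).1 ql.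
  have [a da xa] := ls n x dx.
  apply: (coboundary_sub xa); apply: coboundary_cmap; apply: ri => //.
  by exists 0; rewrite linear0; apply/matrixP => i [].
have zP n (x : X n) :
    (\0 : {linear _ -> zero_cpx R (n + 1)}) (diff X n x)
    = diff (zero_cpx R) n ((\0 : {linear _ -> _}) x) by [].
apply: (@D_iso_quasi_iso _ _ (CMap zP)).
apply/quasi_isoP; split=> n x dx; first by move=> _; exact: aX.
exists 0; first by rewrite linear0.
by exists 0; rewrite linear0; apply/matrixP => i [].
Qed.

End Cohomology.

Section Lifting.
Variables (R : comPzRingType) (S : set R).
Hypothesis mS : mult_closed S.

(** The denominators needed for a finite set of generators have a common
multiple in [S]. *)
Lemma local_projective_lift (P M N : lmodType R) (g : {linear M -> N})
    (f : {linear P -> N}) : fin_gen P -> projective P ->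
  (forall x, exists2 t, S t & exists m, g m = t *: f x) ->
  exists2 t, S t & exists h : {linear P -> M}, forall x, g (h x) = t *: f x.
Proof.
move=> [gens gensP] prP H.
have [t St tP] : exists2 t, S t &
    forall i, (i < size gens)%N -> exists m, g m = t *: f gens`_i.
  elim: gens {gensP} => [|x s [t St tP]]; first by exists 1; [exact: mS.1|].
  have [u Su [m mP]] := H x; exists (u * t); first exact: mS.2.
  case=> [|i] /= i_s; first by exists (t *: m); rewrite linearZ /= mP scalerA mulrC.
  by have [m' m'P] := tP i i_s; exists (u *: m'); rewrite linearZ /= m'P scalerA.
exists t => //.
have tfL : linear (fun x => t *: f x).
  by move=> a x y; rewrite linearP scalerDr !scalerA [t * a]mulrC.
apply: (projective_lift (f := lin_of tfL)) => // x /=; have [c ->] := gensP x.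
have [m mP] : exists m : nat -> M, forall i : 'I_(size gens), g (m i) = t *: f gens`_i.
  have H' (i : nat) : exists m, (i < size gens)%N -> g m = t *: f gens`_i.
    by case: (ltnP i (size gens)) => [/tP[m mP]|_]; [exists m|exists 0].
  by exists (fun i => projT1 (cid (H' i))) => i; case: cid => m /= mP; exact: mP.
exists (\sum_(i < size gens) c i *: m i).
rewrite -[t *: f _]/(lin_of tfL _) !linear_sum; apply: eq_bigr => i _.
by rewrite !linearZ /= mP !scalerA mulrC.
Qed.

Definition local_qis (X Y : complex R) (f : cmap X Y) : Prop := forall n,
  (forall x : X (n + 1), diff X (n + 1) x = 0 -> coboundary (f (n + 1) x) ->
     exists2 t, S t & coboundary (t *: x)) /\
  (forall y : Y (n + 1), diff Y (n + 1) y = 0 ->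
     exists2 t, S t & exists2 x : X (n + 1), diff X (n + 1) x = 0 &
       coboundary (t *: y - f (n + 1) x)).

(** [phi] and the homotopy [h] are constructed by descending induction on the
degree. With S = {1} this lifts maps from a perfect complex through
quasi-isomorphisms; with Y = 0 it contracts P after inverting an element of S. *)
Lemma perfect_lift (P Y Z : complex R) (f : cmap Y Z) (c : cmap P Z) :
  perfect P -> local_qis f ->
  exists2 s, S s & exists (phi : cmap P Y) (h : forall n, {linear P (n + 1) -> Z n}),
    forall n x, f (n + 1) (phi (n + 1) x) - s *: c (n + 1) x
      = diff Z n (h n x) + h (n + 1) (diff P (n + 1) x).
Proof.
move=> [[N PN] fgpP] qf.
  (* The equations that [phi] and [h] must satisfy in degree n + 1. *)
pose good s (phi : forall n, {linear P n -> Y n})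
    (h : forall n, {linear P (n + 1) -> Z n}) n :=
  forall x : P (n + 1),
   phi (n + 1 + 1) (diff P (n + 1) x) = diff Y (n + 1) (phi (n + 1) x) /\
   f (n + 1) (phi (n + 1) x) - s *: c (n + 1) x
      = diff Z n (h n x) + h (n + 1) (diff P (n + 1) x).
have good0 s phi h (n : int) : (N < `|(n + 1)%R|)%N -> good s phi h n.
  by move=> Nn x; rewrite (PN _ Nn x) !linear0.
suff stage k : exists2 s, S s &
    exists phi h, forall n : int, (N%:Z - k%:Z <= n) -> good s phi h n.
  have [s Ss [phi [h phiP]]] := stage (N + N + 2)%N.
  have {}phiP (n : int) : good s phi h n.
    have [Nn|Nn] := leqP `|(n + 1)%R|%N N; last exact: good0.
    by apply: phiP; lia.
  have phi_diff : forall n x, phi (n + 1) (diff P n x) = diff Y n (phi n x).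
    by apply: int_succ_ind => n x; have [] := phiP n x.
  exists s => //; exists (CMap phi_diff), h => n x.
  by have [] := phiP n x.
elim: k => [|k [s Ss [phi [h phiP]]]].
  exists 1; first exact: mS.1.
  exists (fun n => \0), (fun n => \0) => n Nn; apply: good0; lia.
(* The step defines [phi] in degree n0 + 1 and [h] from n0 + 1 to n0. Both are
   found at once, by lifting through the map (y, z) |-> (dy, fy - dz). *)
pose n0 : int := N%:Z - k%:Z - 1.
have n0P : good s phi h (n0 + 1) by apply: phiP; rewrite /n0; lia.
pose g_fun (u : (Y (n0 + 1)%R * Z n0)%type) :
    (Y (n0 + 1 + 1)%R * Z (n0 + 1)%R)%type :=
  (diff Y (n0 + 1) u.1, f (n0 + 1) u.1 - diff Z n0 u.2).
have gL : linear g_fun.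
  move=> a [x y] [x' y']; rewrite /g_fun /= !linearP; congr pair.
  by rewrite /= scalerDr addrACA.
pose t_fun (x : P (n0 + 1)) : (Y (n0 + 1 + 1)%R * Z (n0 + 1)%R)%type :=
  (phi (n0 + 1 + 1) (diff P (n0 + 1) x),
   s *: c (n0 + 1) x + h (n0 + 1) (diff P (n0 + 1) x)).
have tL : linear t_fun.
  move=> a x y; rewrite /t_fun /= !linearP; congr pair.
  by rewrite /= !scalerDr addrACA.
have [x|t St [k0 k0P]] := local_projective_lift (g := lin_of gL) (f := lin_of tL)
    (fgpP _).1 (fgpP _).2.
  have [/= e1 e2] := n0P (diff P (n0 + 1) x).
  have [inj _] := qf (n0 + 1); have [_ surj] := qf n0.
  rewrite diff_diff !linear0 addr0 in e1 e2.
  move/eqP: e2; rewrite subr_eq => /eqP e2.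
  set w := s *: c (n0 + 1) x + h (n0 + 1) (diff P (n0 + 1) x).
  have dw : f _ (phi _ (diff P (n0 + 1) x)) = diff Z (n0 + 1) w.
    by rewrite e2 /w linearD linearZ -cfun_diff [RHS]addrC.
  have [|t St [y0 y0P]] := inj _ (esym e1); first by exists w.
  have [|t' St' [x' dx' [z zP]]] := surj (f _ y0 - t *: w).
    by rewrite linearB -cfun_diff -y0P 2!linearZ /= dw subrr.
  exists (t' * t); first exact: mS.2.
  exists (t' *: y0 - x', z); rewrite /= /g_fun /t_fun /= -/w.
  congr pair; first by rewrite /= linearB linearZ /= dx' subr0 -y0P scalerA.
  by rewrite /= -zP linearB linearZ /= opprB subrKA -scalerBr subKr scalerA.
have e1 x : diff Y (n0 + 1) (k0 x).1 = t *: phi (n0 + 1 + 1) (diff P (n0 + 1) x).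
  exact: (congr1 fst (k0P x)).
have e2 x : f (n0 + 1) (k0 x).1 - diff Z n0 (k0 x).2 =
    t *: (s *: c (n0 + 1) x + h (n0 + 1) (diff P (n0 + 1) x)).
  exact: (congr1 snd (k0P x)).
have k1L : linear (fun x => (k0 x).1) by move=> a x y; rewrite linearP.
have k2L : linear (fun x => (k0 x).2) by move=> a x y; rewrite linearP.
have phiL n : linear (fun x => t *: phi n x).
  by move=> a x y; rewrite linearP scalerDr !scalerA [t * a]mulrC.
have hL n : linear (fun x => t *: h n x).
  by move=> a x y; rewrite linearP scalerDr !scalerA [t * a]mulrC.
exists (t * s); first exact: mS.2.
exists (dfwith (fun n => lin_of (phiL n)) (lin_of k1L)),
       (dfwith (fun n => lin_of (hL n)) (lin_of k2L)) => n Nn x.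
have [nn0|nn0] := eqVneq n0 n.
  move: x; rewrite -nn0 => x.
  rewrite !dfwith_in !dfwith_out /=; try lia.
  split; first by rewrite e1.
  move/eqP: (e2 x); rewrite subr_eq => /eqP ->.
  by rewrite scalerDr scalerA -[LHS]addrA [X in _ + X = _]addrC
    [LHS]addrACA subrr add0r [LHS]addrC.
rewrite !dfwith_out /=; try lia.
have [|f1 f2] := phiP n _ x; first by move: nn0 Nn; rewrite /n0; lia.
split; first by rewrite f1 linearZ.
by rewrite [f _ _]linearZ [diff Z n _]linearZ /= -scalerA -scalerBr f2 scalerDr.
Qed.

End Lifting.

(** * Supports *)

Local Notation frac := Defs.frac.

Section ModuleFractions.
Variables (R : comPzRingType) (p : Spec R) (M : lmodType R).
Implicit Types (u v w : M * denom p) (L : seq (M * loc p)).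

(** Pairs (m, s) stand for the fractions m / s of the localized module M_p. The
tensor product is given by generators and relations, so to see that an element
of it is nonzero one needs a map out of it: [mfrac_eval] sends a formal sum of
tensors to a fraction and respects the relations. *)
Definition mfrac_eq u v : Prop :=
  exists t : denom p, dnm t *: (dnm v.2 *: u.1) = dnm t *: (dnm u.2 *: v.1).

Definition mfrac_add u v : M * denom p :=
  (dnm v.2 *: u.1 + dnm u.2 *: v.1, denomM u.2 v.2).

Definition mfrac_scale (m : M) (x : loc p) : M * denom p :=
  ((repr x).1 *: m, (repr x).2).

Fixpoint mfrac_eval L : M * denom p :=
  if L is (m, x) :: L' then mfrac_add (mfrac_scale m x) (mfrac_eval L')
  else (0, denom1 p).

Lemma mfrac_eqW u v : dnm v.2 *: u.1 = dnm u.2 *: v.1 -> mfrac_eq u v.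
Proof. by move=> e; exists (denom1 p); rewrite e. Qed.

Lemma mfrac_eq_refl u : mfrac_eq u u. Proof. exact: mfrac_eqW. Qed.

Lemma mfrac_eq_sym u v : mfrac_eq u v -> mfrac_eq v u.
Proof. by move=> [t e]; exists t. Qed.

Lemma mfrac_eq_trans u v w : mfrac_eq u v -> mfrac_eq v w -> mfrac_eq u w.
Proof.
case: u v w => [m s] [n r] [l t] [a /= e1] [b /= e2].
exists (denomM (denomM a b) r); rewrite /= !dnmM !scalerA.
have -> : dnm a * dnm b * dnm r * dnm t = dnm b * dnm t * dnm a * dnm r by ring.
rewrite -3!scalerA e1 !scalerA.
have -> : dnm b * dnm t * dnm a * dnm s = dnm a * dnm s * dnm b * dnm t by ring.
rewrite -3!scalerA e2 !scalerA; congr (_ *: _); ring.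
Qed.

Lemma mfrac_addA u v w :
  mfrac_eq (mfrac_add u (mfrac_add v w)) (mfrac_add (mfrac_add u v) w).
Proof.
apply: mfrac_eqW; case: u v w => [m s] [n r] [l t] /=.
rewrite !dnmM !scalerDr !scalerA addrA.
by congr (_ *: _ + _ *: _ + _ *: _); ring.
Qed.

Lemma mfrac_addC u v : mfrac_eq (mfrac_add u v) (mfrac_add v u).
Proof.
apply: mfrac_eqW; case: u v => [m s] [n r] /=.
rewrite !dnmM !scalerDr !scalerA addrC.
by congr (_ *: _ + _ *: _); ring.
Qed.

Lemma mfrac_add_eq u u' v v' : mfrac_eq u u' -> mfrac_eq v v' ->
  mfrac_eq (mfrac_add u v) (mfrac_add u' v').
Proof.
case: u u' v v' => [m s] [m' s'] [n r] [n' r'] [a /= e1] [b /= e2].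
exists (denomM a b); rewrite /= !dnmM !scalerDr !scalerA; congr (_ + _).
  have -> : dnm a * dnm b * (dnm s' * dnm r') * dnm r
    = dnm b * dnm r' * dnm r * dnm a * dnm s' by ring.
  rewrite -2!scalerA e1 !scalerA; congr (_ *: _); ring.
have -> : dnm a * dnm b * (dnm s' * dnm r') * dnm s
    = dnm a * dnm s' * dnm s * dnm b * dnm r' by ring.
rewrite -2!scalerA e2 !scalerA; congr (_ *: _); ring.
Qed.

Lemma mfrac_add0 u : mfrac_eq (mfrac_add u (0, denom1 p)) u.
Proof.
by apply: mfrac_eqW; rewrite /= dnmM !dnm1 scaler0 addr0 mulr1 !scalerA mulr1.
Qed.

Lemma mfrac_eval_cat L L' :
  mfrac_eq (mfrac_eval (L ++ L')) (mfrac_add (mfrac_eval L) (mfrac_eval L')).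
Proof.
elim: L => [|[m x] L IH] /=.
  exact: (mfrac_eq_trans (mfrac_eq_sym (mfrac_add0 _)) (mfrac_addC _ _)).
apply: mfrac_eq_trans (mfrac_addA _ _ _).
by apply: mfrac_add_eq IH; exact: mfrac_eq_refl.
Qed.

Lemma mfrac_scale_frac m a s : mfrac_eq (mfrac_scale m (frac a s)) (a *: m, s).
Proof.
have [u e] := repr_frac a s; exists u.
by rewrite /= !scalerA !mulrA in e *; rewrite e. Qed.

Lemma mfrac_eval1 m x : mfrac_eq (mfrac_eval [:: (m, x)]) (mfrac_scale m x).
Proof. exact: mfrac_add0. Qed.

Lemma mfrac_eval2 m x n y : mfrac_eq (mfrac_eval [:: (m, x); (n, y)])
  (mfrac_add (mfrac_scale m x) (mfrac_scale n y)).
Proof. by apply: mfrac_add_eq (mfrac_eval1 _ _); exact: mfrac_eq_refl. Qed.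

Lemma mfrac_scaleDr m x y : mfrac_eq (mfrac_scale m (x + y))
  (mfrac_add (mfrac_scale m x) (mfrac_scale m y)).
Proof.
have [a [s ->]] := frac_surj x; have [b [t ->]] := frac_surj y.
rewrite [_ + _]locDE; apply: mfrac_eq_trans (mfrac_scale_frac _ _ _) _.
apply: mfrac_eq_trans (mfrac_eq_sym _); last first.
  by apply: mfrac_add_eq; exact: mfrac_scale_frac.
by apply: mfrac_eqW; rewrite /= scalerDl !scalerA.
Qed.

Lemma mfrac_scale_bal a m x : mfrac_eq (mfrac_scale (a *: m) x) (mfrac_scale m (a *: x)).
Proof.
have [b [s ->]] := frac_surj x; rewrite [a *: frac _ _]locZE.
apply: mfrac_eq_trans (mfrac_scale_frac _ _ _) (mfrac_eq_sym _).
apply: mfrac_eq_trans (mfrac_scale_frac _ _ _) _.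
by apply: mfrac_eqW; rewrite /= !scalerA; congr (_ *: _); ring.
Qed.

Lemma mfrac_eval_eq L L' : tens_eq L L' -> mfrac_eq (mfrac_eval L) (mfrac_eval L').
Proof.
elim=> {L L'}.
- by move=> L; exact: mfrac_eq_refl.
- by move=> L L' _; exact: mfrac_eq_sym.
- by move=> L L' L'' _ e _; exact: mfrac_eq_trans.
- move=> L L' K K' _ eL _ eK; apply: mfrac_eq_trans (mfrac_eval_cat _ _) _.
  exact: mfrac_eq_trans (mfrac_add_eq eL eK) (mfrac_eq_sym (mfrac_eval_cat _ _)).
- move=> L K; apply: mfrac_eq_trans (mfrac_eval_cat _ _) _.
  exact: mfrac_eq_trans (mfrac_addC _ _) (mfrac_eq_sym (mfrac_eval_cat _ _)).
- move=> x; apply: mfrac_eq_trans (mfrac_eval1 _ _) _.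
  by apply: mfrac_eqW; rewrite /= !scaler0.
- move=> m n x; apply: mfrac_eq_trans (mfrac_eval1 _ _) _.
  apply: mfrac_eq_trans (mfrac_eq_sym (mfrac_eval2 _ _ _ _)).
  apply: mfrac_eqW; rewrite /= dnmM !scalerDr !scalerA.
  by congr (_ *: _ + _ *: _); ring.
- move=> m x y; apply: mfrac_eq_trans (mfrac_eval1 _ _) _.
  exact: mfrac_eq_trans (mfrac_scaleDr _ _ _) (mfrac_eq_sym (mfrac_eval2 _ _ _ _)).
- move=> a m x; apply: mfrac_eq_trans (mfrac_eval1 _ _) _.
  exact: mfrac_eq_trans (mfrac_scale_bal _ _ _) (mfrac_eq_sym (mfrac_eval1 _ _)).
Qed.

(** The element m (x) 1/s; by [tfrac_surj] and [tfrac_eq0], M (x) R_p consists of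
such elements and its zeros are torsion. *)
Definition tfrac (m : M) (s : denom p) : tensor M (loc p) :=
  tens_pi [:: (m, frac 1 s)].

Lemma tfracP m s n t : tfrac m s = tfrac n t -> mfrac_eq (m, s) (n, t).
Proof.
move=> /tens_piP/mfrac_eval_eq e.
have h m' s' : mfrac_eq (mfrac_eval [:: (m', frac 1 s')]) (m', s').
  apply: mfrac_eq_trans (mfrac_eval1 _ _) _.
  by rewrite -[in X in mfrac_eq _ X](scale1r m'); exact: mfrac_scale_frac.
exact: mfrac_eq_trans (mfrac_eq_sym (h _ _)) (mfrac_eq_trans e (h _ _)).
Qed.

Lemma tens_bal_pi a (m : M) (x : loc p) :
  tens_pi [:: (a *: m, x)] = tens_pi [:: (m, a *: x)].
Proof. by apply/tens_piP; exact: tens_bal. Qed.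

Lemma tfrac_scale (m : M) (s t : denom p) : tfrac m s = tfrac (dnm t *: m) (denomM t s).
Proof.
rewrite /tfrac tens_bal_pi; congr (tens_pi [:: (m, _)]).
by rewrite [_ *: _]locZE; apply: frac_eqW; rewrite dnmM; ring.
Qed.

Lemma tfracD m n s : tfrac (m + n) s = tfrac m s + tfrac n s.
Proof. by rewrite [RHS]tensDE; apply/tens_piP; exact: tens_Dl. Qed.

Lemma tfrac0 s : tfrac 0 s = 0.
Proof. by apply/tens_piP; exact: tens_0l. Qed.

Lemma tfrac_surj (x : tensor M (loc p)) : exists m s, x = tfrac m s.
Proof.
rewrite -(tens_piK x); elim: (repr x) => [|[m y] L [n [t e]]].
  by exists 0, (denom1 p); rewrite tfrac0.
have [a [s ->]] := frac_surj y.
exists (dnm t *: (a *: m) + dnm s *: n), (denomM s t).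
rewrite -cat1s -[LHS]tensDE [tens_pi L]e tfracD -tfrac_scale; congr (_ + _).
have -> : tfrac (dnm t *: (a *: m)) (denomM s t) = tfrac (a *: m) s.
  rewrite (tfrac_scale _ s t); congr tfrac.
  by apply: val_inj; rewrite /= mulrC.
rewrite /tfrac tens_bal_pi; congr (tens_pi [:: (m, _)]).
by rewrite [a *: _]locZE mulr1.
Qed.

Lemma tfrac_eq0 m s : tfrac m s = 0 -> exists t : denom p, dnm t *: m = 0.
Proof.
rewrite -(tfrac0 s) => /tfracP[t /= e]; exists (denomM t s).
by rewrite dnmM -scalerA e !scaler0.
Qed.

End ModuleFractions.

Lemma tens_map_tfrac (R : comPzRingType) (p : Spec R) (M N : lmodType R)
    (f : {linear M -> N}) m s : tens_map f (tfrac (p := p) m s) = tfrac (f m) s.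
Proof. exact: tens_mapE. Qed.

Local Notation away p := (~` (spec_set p)).

Section Support.
Variable R : comPzRingType.
Implicit Types (X Y : complex R) (p : Spec R) (S : set R).

(** The cohomology class of [x] becomes zero after inverting [S]. *)
Definition coh_killed S X n (x : X (n + 1)) : Prop :=
  exists2 t, S t & coboundary (t *: x).

Definition cohomology_torsion S X : Prop :=
  forall n (x : X (n + 1)), diff X (n + 1) x = 0 -> coh_killed S x.

(** Exactness of localization: acyclicity of X (x) R_p depends only on the
cohomology modules of X. *)
Lemma tens_loc_acyclicP X p :
  acyclic (tens_cpx X (loc p)) <-> cohomology_torsion (away p) X.
Proof.
split=> [aX n x dx|tX n x].
  have [|y] := aX n (tfrac x (denom1 p)); first by rewrite /= tens_map_tfrac dx tfrac0.
  have [m [s ->]] := tfrac_surj y; rewrite /= tens_map_tfrac => /tfracP[t /= e].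
  exists (dnm t * dnm s); first by rewrite -dnmM; exact: denomP.
  by exists (dnm t *: m); rewrite linearZ /= -scalerA e dnm1 scale1r.
have [m [s ->]] := tfrac_surj x; rewrite /= tens_map_tfrac => /tfrac_eq0[t e].
have [|u pu [y yP]] := tX n (dnm t *: m); first by rewrite linearZ.
have u' : u \in ~` (p : set R) by exact/mem_set.
pose d : denom p := exist _ u u'.
exists (tfrac y (denomM d (denomM t s))); rewrite /= tens_map_tfrac -yP.
exact: etrans (tfrac_scale m s t) (tfrac_scale _ _ d).
Qed.

Lemma SuppP X p : Supp X p <-> ~ cohomology_torsion (away p) X.
Proof. by rewrite /Supp /= D_iso_zeroP tens_loc_acyclicP. Qed.

Lemma not_SuppP X p : ~ Supp X p <-> cohomology_torsion (away p) X.
Proof. by rewrite SuppP notK. Qed.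

Lemma coh_surj_torsion S X Y (f : cmap X Y) :
  coh_surj f -> cohomology_torsion S X -> cohomology_torsion S Y.
Proof.
move=> fs tX n y dy; have [x dx yx] := fs n y dy; have [t St tx] := tX n x dx.
exists t => //; rewrite -(subrK (f (n + 1) x) y) scalerDr.
apply: coboundaryD; first exact: coboundaryZ.
by rewrite -linearZ; exact: coboundary_cmap.
Qed.

Lemma coh_inj_torsion S X Y (f : cmap X Y) :
  coh_inj f -> cohomology_torsion S Y -> cohomology_torsion S X.
Proof.
move=> fi tY n x dx; have [|t St tx] := tY n (f (n + 1) x); first exact: cocycle_cmap.
by exists t => //; apply: fi; [rewrite linearZ /= dx scaler0|rewrite linearZ].
Qed.

Lemma quasi_iso_Supp X Y (f : cmap X Y) : quasi_iso f -> Supp X = Supp Y.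
Proof.
move=> /quasi_isoP[fi fs]; apply/seteqP; split=> p; rewrite !SuppP; apply: contra_not.
  exact: coh_inj_torsion fi.
exact: coh_surj_torsion fs.
Qed.

Definition null_homotopic (c : R) X : Prop :=
  exists h : forall n, {linear X (n + 1) -> X n},
    forall n x, c *: x = diff X n (h n x) + h (n + 1) (diff X (n + 1) x).

Lemma null_homotopic_coboundary c X n (x : X (n + 1)) :
  null_homotopic c X -> diff X (n + 1) x = 0 -> coboundary (c *: x).
Proof. by move=> [h ->] ->; rewrite linear0 addr0; exact: coboundary_diff. Qed.

Lemma null_homotopic_ideal X : is_ideal [set c | null_homotopic c X].
Proof.
split=> /=.
- by exists (fun n => \0) => n x; rewrite scale0r linear0 addr0.
- move=> c d [h hP] [k kP].
  have hkL n : linear (fun x => h n x + k n x).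
    by move=> a x y; rewrite !linearP addrACA scalerDr.
  exists (fun n => lin_of (hkL n)) => n x /=.
  by rewrite scalerDl hP kP linearD addrACA.
- move=> a c [h hP].
  have ahL n : linear (fun x => a *: h n x).
    by move=> b x y; rewrite linearP scalerDr !scalerA [a * b]mulrC.
  exists (fun n => lin_of (ahL n)) => n x /=.
  by rewrite -scalerA hP scalerDr linearZ.
Qed.

Lemma torsion_null_homotopic S X : mult_closed S -> perfect X ->
  cohomology_torsion S X -> exists2 s, S s & null_homotopic s X.
Proof.
move=> mS pX tX.
have zP n (x : zero_cpx R n) :
  (\0 : {linear zero_cpx R (n + 1) -> X (n + 1)}) (diff (zero_cpx R) n x)
    = diff X n ((\0 : {linear zero_cpx R n -> X n}) x).
  by rewrite [RHS]linear0.
have [|s Ss [phi [h hP]]] := perfect_lift mS (f := CMap zP) (cmap_id X) pX.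
  move=> n; split=> x dx.
    by move=> _; exists 1; [exact: mS.1|exists 0; apply/matrixP => i []].
  have [t St tx] := tX n x dx; exists t => //; exists 0; first by rewrite linear0.
  by rewrite /= subr0.
have hL n : linear (fun x => - h n x).
  by move=> a x y; rewrite linearP opprD scalerN.
exists s => //; exists (fun n => lin_of (hL n)) => n x /=.
by rewrite linearN -opprD -hP sub0r opprK.
Qed.

(** A perfect complex is acyclic at p only if one denominator outside p works
for the contraction in all degrees. *)
Lemma Supp_zeros X : perfect X -> Supp X = zeros [set c | null_homotopic c X].
Proof.
move=> pX; apply/seteqP; split=> p.
  rewrite SuppP => tX c cX; apply: contrapT => pc; apply: tX => n x dx.
  by exists c => //; exact: null_homotopic_coboundary.
move=> pX0; apply/SuppP => /(torsion_null_homotopic (mult_closed_prime p) pX).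
by case=> s ps /pX0.
Qed.

Lemma coboundary_ideal X n (x : X (n + 1)) : is_ideal [set t | coboundary (t *: x)].
Proof.
split=> /=.
- by rewrite scale0r; exact: coboundary0.
- by move=> s t sx tx; rewrite scalerDl; exact: coboundaryD.
- by move=> a s sx; rewrite -scalerA; exact: coboundaryZ.
Qed.

(** The annihilator of the class of [x] lies in no prime. *)
Lemma coboundary_local X n (x : X (n + 1)) : noetherian R ->
  (forall p, coh_killed (away p) x) -> coboundary x.
Proof.
move=> hR xp; rewrite -[x]scale1r.
apply: (ideal_unit_or_prime hR (coboundary_ideal x)) => p.
by have [t] := xp p; exists t.
Qed.

End Support.

(** * Splitting a homotopy idempotent *)

(** If dh + hd = c then k = hdh satisfies dk + kd = c^2 and k^2 = 0, since
dhd = cd and d^2 = 0. *)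
Lemma null_homotopic_square (R : comPzRingType) (X : complex R) (c : R) :
  null_homotopic c X -> exists k : forall n, {linear X (n + 1) -> X n},
    (forall n x, k n (k (n + 1) x) = 0) /\
    (forall n x, c ^+ 2 *: x = diff X n (k n x) + k (n + 1) (diff X (n + 1) x)).
Proof.
move=> [h hP].
have dhd n x : diff X n (h n (diff X n x)) = c *: diff X n x.
  by rewrite hP diff_diff linear0 addr0.
exists (fun n => h n \o (diff X n \o h n)); split=> n x /=.
  set u := h (n + 1) (diff X (n + 1) (h (n + 1) x)).
  have /eqP := hP n u; rewrite [diff X (n + 1) u]dhd -subr_eq => /eqP <-.
  by rewrite [h (n + 1) (_ *: _)]linearZ subrr linear0.
by rewrite !dhd [h _ (_ *: _)]linearZ /= expr2 -scalerA (hP n x) scalerDr.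
Qed.

Definition odd_int (n : int) : bool := odd `|n|%N.

Lemma odd_intS n : odd_int (n + 1) = ~~ odd_int n.
Proof. by rewrite /odd_int; lia. Qed.

Section HomotopyIdempotent.
Variables (R : comPzRingType) (X : complex R) (N : nat).
Hypothesis XN : forall n : int, (N < `|n|)%N -> forall x : X n, x = 0.
Variables (a b : R) (k : forall n, {linear X (n + 1) -> X n}).
Hypothesis ab1 : a + b = 1.
Hypothesis kk : forall n x, k n (k (n + 1) x) = 0.
Hypothesis dk : forall n x,
  (a * b) *: x = diff X n (k n x) + k (n + 1) (diff X (n + 1) x).

Local Notation Q := (dsum (fun n : int => X n)).

Definition degrees : seq int := [seq i%:Z - N%:Z | i <- iota 0 (N + N).+1].

Lemma degrees_uniq : uniq degrees.
Proof. by rewrite map_inj_uniq ?iota_uniq // => i j; lia. Qed.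

Lemma degreesP (n : int) : (n \in degrees) = (`|n| <= N)%N.
Proof.
apply/mapP/idP => [[i]|nN]; first by rewrite mem_iota => iN ->; lia.
by exists `|(n + N%:Z)%R|%N; rewrite ?mem_iota; lia.
Qed.

Lemma bounded_support (F : forall n, X n) : finite_set [set n | F n != 0].
Proof.
apply: (@sub_finite_set _ _ [set` degrees]); last exact: finite_seq.
move=> n /= /eqP Fn; rewrite degreesP leqNgt; apply/negP => nN.
by apply: Fn; exact: XN.
Qed.

Definition gather (F : forall n, X n) : Q := Dsum (bounded_support F).

(** Component n receives the differential from degree n - 1, transported along
n - 1 + 1 = n; [tot_diff_funE] restates it without the transport. *)
Definition tot_diff_fun (x : Q) : Q := gather (fun n =>
  eq_rect (n - 1 + 1) (fun i => X i : Type) (diff X (n - 1) (x (n - 1))) n (subrK 1 n)).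

Lemma tot_diff_funE x n : tot_diff_fun x (n + 1) = diff X n (x n).
Proof.
rewrite /tot_diff_fun /=; move: (subrK 1 (n + 1)).
have -> : n + 1 - 1 = n by rewrite addrK.
by move=> e; rewrite (Prop_irrelevance e erefl).
Qed.

Lemma tot_diff_linear : linear tot_diff_fun.
Proof.
move=> c x y; apply: dsum_ext; apply: int_succ_ind => n.
rewrite -[RHS]/(c *: tot_diff_fun x (n + 1) + tot_diff_fun y (n + 1)).
by rewrite !tot_diff_funE -linearP.
Qed.
Definition tot_diff : {linear Q -> Q} := lin_of tot_diff_linear.

Lemma tot_htpy_linear : linear (fun x : Q => gather (fun n => k n (x (n + 1)))).
Proof. by move=> c x y; apply: dsum_ext => n /=; rewrite -linearP. Qed.
Definition tot_htpy : {linear Q -> Q} := lin_of tot_htpy_linear.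

Definition weight (n : int) : R := if odd_int n then a else b.

Lemma weight_op_linear : linear (fun x : Q => gather (fun n => weight n *: x n)).
Proof.
move=> c x y; apply: dsum_ext => n /=.
by rewrite scalerDr !scalerA [weight n * c]mulrC.
Qed.
Definition weight_op : {linear Q -> Q} := lin_of weight_op_linear.

Lemma trunc_linear m :
  linear (fun x : Q => gather (fun n => if m <= n then x n else 0)).
Proof.
move=> c x y; apply: dsum_ext => n /=.
by case: ifP => // _; rewrite scaler0 addr0.
Qed.
Definition trunc_ge m : {linear Q -> Q} := lin_of (trunc_linear m).

Lemma truncE m (x : Q) n : trunc_ge m x n = if m <= n then x n else 0.
Proof. by []. Qed.
Arguments trunc_ge : simpl never.

(** The operator q = d + k + weight. As d + k shifts degrees by one, and the
weights in neighbouring degrees add up to a + b = 1, it satisfies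
q^2 = ab + (d + k) + weight^2 = q ([idem_idem]). *)
Lemma idem_linear : linear (fun x : Q => tot_diff x + tot_htpy x + weight_op x).
Proof.
by move=> c x y; rewrite !linearP !scalerDr [in RHS]addrACA [in X in _ = X + _]addrACA.
Qed.
Definition idem : {linear Q -> Q} := lin_of idem_linear.

Lemma idemE (x : Q) n : idem x (n + 1) =
  diff X n (x n) + k (n + 1) (x (n + 1 + 1)) + weight (n + 1) *: x (n + 1).
Proof. by rewrite -tot_diff_funE. Qed.

Arguments idem : simpl never.

Lemma weightS m : weight (m + 1) + weight m = 1.
Proof. by rewrite /weight odd_intS; case: odd_int; rewrite // addrC. Qed.

Lemma weight_idem m : weight m * weight m + a * b = weight m.
Proof.
rewrite /weight; case: odd_int; first by rewrite -mulrDr ab1 mulr1.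
by rewrite -mulrDl addrC ab1 mul1r.
Qed.

Lemma idem_idem (x : Q) : idem (idem x) = idem x.
Proof.
apply: dsum_ext; apply: int_succ_ind; apply: int_succ_ind => n.
rewrite [LHS]idemE [in RHS]idemE 3!idemE.
rewrite ![diff X _ (_ + _)]linearD ![k _ (_ + _)]linearD !linearZ /= diff_diff kk add0r addr0.
rewrite [in LHS]scalerDr [in LHS]scalerDr.
rewrite [LHS](AC (2*2*3) ((1*3)*(5*2)*(4*6)*7)) /= -dk -!scalerDl !weightS.
by rewrite !scale1r scalerA (AC 4 (2*3*(4*1))) /= -scalerDl weight_idem.
Qed.

(** q in even degrees and q - 1 in odd ones, so that consecutive operators
compose to zero. *)
Lemma osc_linear n : linear (fun x : Q => idem x - (odd_int n)%:R *: x).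
Proof.
move=> c x y; rewrite [idem _]linearP [_%:R *: (_ + _)]scalerDr opprD addrACA.
by rewrite scalerBr !scalerA [c * _]mulrC.
Qed.
Definition osc n : {linear Q -> Q} := lin_of (osc_linear n).
Arguments osc : simpl never.

Lemma osc_def n (x : Q) : osc n x = idem x - (odd_int n)%:R *: x.
Proof. by []. Qed.

Lemma oscE m (x : Q) n : osc m x (n + 1) = diff X n (x n)
  + k (n + 1) (x (n + 1 + 1)) + (weight (n + 1) - (odd_int m)%:R) *: x (n + 1).
Proof.
rewrite -[LHS]/(idem x (n + 1) + (- ((odd_int m)%:R *: x)) (n + 1)).
by rewrite idemE scalerBl [RHS]addrA /= scaleN1r.
Qed.

Lemma osc_osc n (x : Q) : osc (n + 1) (osc n x) = 0.
Proof.
rewrite !osc_def [idem (_ - _)]linearB idem_idem [idem (_ *: _)]linearZ /= odd_intS.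
by case: odd_int; rewrite !(scale1r, scale0r, subr0, subrr).
Qed.

Lemma trunc_eq0 m (x : Q) : (forall n, m <= n -> x n = 0) -> trunc_ge m x = 0.
Proof. by move=> x0; apply: dsum_ext => n; rewrite truncE; case: ifP => // /x0. Qed.

(** d + k + weight raises the degree by at most one, so what lies below degree
n cannot reach degree n + 1. Hence the truncations may be inserted in, or
removed from, a composite of two oscillating operators. *)
Lemma osc_low m n (x : Q) : (forall i, n <= i -> x i = 0) ->
  trunc_ge (n + 1) (osc m x) = 0.
Proof.
move=> x0; apply: trunc_eq0; apply: int_succ_ind => i ni.
by rewrite oscE !x0 ?linear0 ?scaler0 ?addr0 //; lia.
Qed.

Lemma trunc_id m (x : Q) : (forall n, n < m -> x n = 0) -> trunc_ge m x = x.
Proof.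
move=> x0; apply: dsum_ext => n; rewrite truncE.
by have [//|/x0->] := lerP m n.
Qed.

Lemma trunc_trunc m n (x : Q) : m <= n -> trunc_ge m (trunc_ge n x) = trunc_ge n x.
Proof.
move=> mn; apply: trunc_id => i im; rewrite truncE ifF //; lia.
Qed.

Lemma trunc_osc_trunc m n (x : Q) :
  trunc_ge (n + 1) (osc m (trunc_ge n x)) = trunc_ge (n + 1) (osc m x).
Proof.
apply/eqP; rewrite -subr_eq0 -!linearB; apply/eqP/osc_low => i ni.
by rewrite -[LHS]/(trunc_ge n x i + (- x) i) truncE ni /= scaleN1r subrr.
Qed.

(** Any even degree below all nonzero terms of [X] would do: the truncations in
degrees up to [bottom] + 1 are the identity of Q, so the complex may be stopped
in degree [bottom] at q(Q), the image of the even operator. *)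
Definition bottom : int := - (N.*2.+2)%:Z.

(** The n-th term of the split-off complex is the image of [cut n]. *)
Definition cut (n : int) : {linear Q -> Q} :=
  if bottom < n then trunc_ge n else if n == bottom then idem else \0.

Lemma odd_bottom : odd_int bottom = false.
Proof. by rewrite /odd_int /bottom; lia. Qed.

Lemma cut_trunc n : bottom < n -> cut n = trunc_ge n.
Proof. by rewrite /cut => ->. Qed.

Lemma cut_bottom : cut bottom = idem.
Proof. by rewrite /cut ltxx eqxx. Qed.

Lemma cut_low n (x : Q) : n < bottom -> cut n x = 0.
Proof. by move=> nb; rewrite /cut ifF ?ifF //; lia. Qed.

Lemma cut_idem n (x : Q) : cut n (cut n x) = cut n x.
Proof.
have [nb|nb|->] := ltgtP n bottom; first by rewrite !(cut_low _ nb).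
  by rewrite cut_trunc // trunc_trunc.
by rewrite cut_bottom idem_idem.
Qed.

Lemma X_low n (x : X n) : n <= bottom -> x = 0.
Proof. by move=> nb; apply: XN; move: nb; rewrite /bottom; lia. Qed.

Lemma trunc_low n (x : Q) : n <= bottom + 1 -> trunc_ge n x = x.
Proof.
by move=> nb; apply: trunc_id => i im; apply: X_low; lia.
Qed.

Notation factor_obj n := (limage (cut n)).

Lemma cut_lval n (x : factor_obj n) : cut n (lval x) = lval x.
Proof. by have [y <-] := lvalP x; exact: cut_idem. Qed.

Lemma factor_low n (x : factor_obj n) : n < bottom -> x = 0.
Proof. by move=> nb; apply: lval_inj; rewrite -cut_lval cut_low. Qed.

Lemma cut_corestrict (L : lmodType R) n (f : {linear L -> Q}) x :
  exists y, cut n y = (cut n \o f) x.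
Proof. by exists (f x). Qed.

Definition corestrict (L : lmodType R) n (f : {linear L -> Q}) :
    {linear L -> factor_obj n} := colimage (cut_corestrict n f).

Lemma corestrictE (L : lmodType R) n (f : {linear L -> Q}) x :
  lval (corestrict n f x) = cut n (f x).
Proof. by []. Qed.

Definition factor_diff n : {linear factor_obj n -> factor_obj (n + 1)} :=
  corestrict (n + 1) (osc n \o @lval _ _ _ (cut n)).

Lemma factor_diffE n (x : factor_obj n) :
  lval (factor_diff n x) = cut (n + 1) (osc n (lval x)).
Proof. by []. Qed.

Lemma factor_diff_diff n (x : factor_obj n) : factor_diff (n + 1) (factor_diff n x) = 0.
Proof.
have [nb|bn] := ltrP n bottom; first by rewrite (factor_low x nb) !linear0.
apply: lval_inj; rewrite !factor_diffE !cut_trunc; try lia.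
by rewrite trunc_osc_trunc osc_osc linear0.
Qed.

Definition factor : complex R := Complex factor_diff_diff.

Lemma factor_perfect : (forall n, fin_gen (X n) /\ projective (X n)) -> perfect factor.
Proof.
move=> fgpX; split.
  exists N.*2.+2 => n nN x; apply: lval_inj.
  rewrite -cut_lval -[RHS]/(0 : Q); move: (lval x) => {}x.
  have [nb|nb|nb] := ltgtP n bottom; first by rewrite cut_low.
    rewrite cut_trunc //; apply: trunc_eq0 => i ni; apply: XN.
    by move: nb nN; rewrite /bottom; lia.
  by move: nN; rewrite nb /bottom; lia.
have Xdeg n (x : X n) : n \notin degrees -> x = 0.
  by rewrite degreesP -ltnNge => nN; exact: XN.
move=> n; pose r : {linear Q -> factor n} := corestrict n (idfun : {linear Q -> Q}).
have rK : cancel (@lval _ _ _ (cut n)) r.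
  by move=> x; apply: lval_inj; exact: cut_lval.
split.
  apply: (fin_gen_surj (f := r)); first by move=> y; exists (lval y).
  by apply: (dsum_fin_gen degrees_uniq Xdeg) => i; have [] := fgpX i.
apply: (projective_retract rK).
by apply: (dsum_projective degrees_uniq Xdeg) => i; have [] := fgpX i.
Qed.

Lemma trunc_din n (y : X n) : trunc_ge n (din y) = din y.
Proof.
by apply: trunc_id => i im; apply: din_out => ni; move: im; rewrite ni ltxx.
Qed.

(** Of q applied to an element of X^n, the truncation keeps only the component
of degree n + 1, which is the differential of [X]. *)
Lemma factor_in_diff n (y : X n) :
  corestrict (n + 1) (@din _ _ _ (n + 1)) (diff X n y)
  = factor_diff n (corestrict n (@din _ _ _ n) y).
Proof.
have [nb|bn] := lerP n bottom; first by rewrite (X_low y nb) !linear0.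
apply: lval_inj; rewrite factor_diffE !corestrictE !cut_trunc; try lia.
rewrite !trunc_din; apply: dsum_ext; apply: int_succ_ind => i.
rewrite truncE; case: ifP => [ni|/negbT ni]; last first.
  by rewrite din_out // => e; move: ni; rewrite e lexx.
rewrite oscE [din y (i + 1)]din_out ?[din y (i + 1 + 1)]din_out; try lia.
rewrite linear0 scaler0 !addr0.
have [ei|ei] := eqVneq i n; first by subst i; rewrite !din_in.
rewrite [in RHS]din_out ?linear0 ?din_out //; try lia.
Qed.

Definition factor_in : cmap X factor :=
  @CMap _ X factor (fun n => corestrict n (@din _ _ _ n)) factor_in_diff.

(** q and q - 1 act on the lowest component by b and by a - 1 = - b; the sign
corrects this. *)
Definition sgn (n : int) : R := (-1) ^+ odd_int n.

Lemma sgnS n : sgn (n + 1) = - sgn n.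
Proof. by rewrite /sgn odd_intS; case: odd_int; rewrite ?opprK. Qed.

Lemma factor_out_linear n :
  linear (fun x : factor n => sgn n *: osc n (lval x) n).
Proof.
move=> c x y; rewrite [osc n _]linearP scalerA [c * _]mulrC -scalerA.
exact: scalerDr.
Qed.

Lemma factor_out_diff n (x : factor n) :
  lin_of (@factor_out_linear (n + 1)) (diff factor n x)
  = diff X n (lin_of (@factor_out_linear n) x).
Proof.
have [nb|bn] := ltrP n bottom; first by rewrite (factor_low x nb) !linear0.
rewrite -[RHS]/(diff X n (sgn n *: osc n (lval x) n)) linearZ.
rewrite -[LHS]/(sgn (n + 1) *: osc (n + 1) (lval (factor_diff n x)) (n + 1)).
rewrite factor_diffE cut_trunc; last lia.
have : osc (n + 1) (osc n (lval x)) (n + 1) = 0 by rewrite osc_osc.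
rewrite oscE => e.
rewrite oscE !truncE ifF; last lia.
rewrite ifT; last lia.
rewrite ifT; last lia.
rewrite linear0 add0r sgnS scaleNr -scalerN; congr (_ *: _).
by apply/esym/eqP; rewrite -addr_eq0 addrA e.
Qed.

Definition factor_out : cmap factor X :=
  @CMap _ factor X (fun n => lin_of (@factor_out_linear n)) factor_out_diff.

Lemma factor_out_in n (x : X n) : factor_out n (factor_in n x) = b *: x.
Proof.
have [nb|bn] := lerP n bottom; first by rewrite (X_low x nb) !linear0.
rewrite -[LHS]/(sgn n *: osc n (cut n (din x)) n) cut_trunc // trunc_din.
move: x bn; pattern n; move: n; apply: int_succ_ind => n x _.
rewrite oscE [din x n]din_out ?[din x (n + 1 + 1)]din_out; try lia.
rewrite !linear0 !add0r din_in scalerA; congr (_ *: _).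
rewrite /weight /sgn; case: odd_int; last by rewrite subr0 expr0 mul1r.
by rewrite mulN1r opprB -ab1 addrC addKr.
Qed.

(** The homotopy is (up to sign) the inclusion of the terms of degrees i >= n + 1
into those of degrees i >= n: consecutive oscillating operators differ by the
identity, and the truncations by the component of degree n + 1. *)
Lemma factor_in_out n (x : factor (n + 1)) : diff factor (n + 1) x = 0 ->
  coboundary (x - factor_in (n + 1) (factor_out (n + 1) x)).
Proof.
move=> /(congr1 (@lval _ _ _ _)); rewrite factor_diffE -[RHS]/(0 : Q) => dx.
have [nb|bn|nb] := ltgtP (n + 1) bottom.
- by rewrite (factor_low x nb) !linear0 addr0; exact: coboundary0.
- pose z : factor n := corestrict n (@lval _ _ _ (cut (n + 1))) x.
  exists (sgn n *: z).
  have -> : diff factor n (sgn n *: z) = sgn n *: factor_diff n z by exact: linearZ.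
  apply: lval_inj; rewrite -[RHS]/(sgn n *: lval (factor_diff n z)) factor_diffE.
  rewrite -[lval z]/(cut n (lval x)).
  rewrite -[LHS]/(lval x - cut (n + 1)
    (din (sgn (n + 1) *: osc (n + 1) (lval x) (n + 1)))).
  have {z} := cut_lval x; move: (lval x : Q) dx => {}x.
  rewrite (cut_trunc bn) (cut_trunc (n := n + 1 + 1)); last by move: bn; lia.
  rewrite trunc_din => dx tx.
  have -> : osc n (cut n x) = osc n x.
    have [nb|bn'|->] := ltgtP n bottom; first by lia.
      by rewrite cut_trunc // -tx trunc_trunc //; lia.
    by rewrite !osc_def cut_bottom odd_bottom !scale0r !subr0 idem_idem.
  have -> : osc n x = osc (n + 1) x + sgn n *: x.
    rewrite !osc_def odd_intS /sgn; case: odd_int.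
      by rewrite scale0r subr0 expr1 scaleN1r scale1r.
    by rewrite scale0r subr0 expr0 scale1r subrK.
  have e : trunc_ge (n + 1) (osc (n + 1) x) = din (osc (n + 1) x (n + 1)).
    apply: dsum_ext => i; have [->|ni] := eqVneq i (n + 1).
      by rewrite truncE lexx din_in.
    rewrite din_out; last by move=> ni'; rewrite ni' eqxx in ni.
    rewrite truncE; case: ifP => // ni'.
    have : trunc_ge (n + 1 + 1) (osc (n + 1) x) i = 0 by rewrite dx.
    by rewrite truncE ifT //; lia.
  rewrite [trunc_ge _ (_ + _)]linearD.
  have -> : trunc_ge (n + 1) (sgn n *: x) = sgn n *: x by rewrite linearZ tx.
  rewrite e; move: (osc _ x (n + 1)) => u.
  have -> : din (sgn (n + 1) *: u) = - (sgn n *: din u).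
    by rewrite sgnS scaleNr linearN linearZ.
  by rewrite opprK scalerDr scalerA /sgn -expr2 sqrr_sign scale1r addrC.
- have x0 : lval x = 0.
    rewrite -cut_lval; move: (lval x : Q) (cut_lval x) dx => {}x.
    rewrite nb cut_bottom (cut_trunc (n := bottom + 1)); last lia.
    rewrite trunc_low // osc_def odd_bottom scale0r subr0 => e.
    by [].
  have -> : x = 0 by apply: lval_inj.
  by rewrite !linear0 addr0; exact: coboundary0.
Qed.

End HomotopyIdempotent.

(** In the derived category [Y] is the direct summand of [X] cut out by the
idempotent b. *)
Lemma homotopy_idempotent_split (R : comPzRingType) (X : complex R) (a b : R)
    (k : forall n, {linear X (n + 1) -> X n}) : perfect X -> a + b = 1 ->
  (forall n x, k n (k (n + 1) x) = 0) ->
  (forall n x, (a * b) *: x = diff X n (k n x) + k (n + 1) (diff X (n + 1) x)) ->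
  exists (Y : complex R) (i : cmap X Y) (r : cmap Y X), [/\ perfect Y,
    (forall n x, r n (i n x) = b *: x) &
    (forall n (y : Y (n + 1)), diff Y (n + 1) y = 0 ->
      coboundary (y - i (n + 1) (r (n + 1) y)))].
Proof.
move=> [[N XN] fgpX] ab1 kk dk.
exists (factor XN ab1 kk dk), (factor_in XN ab1 kk dk), (factor_out XN ab1 kk dk); split.
- exact: factor_perfect.
- exact: factor_out_in.
- exact: factor_in_out.
Qed.

(** * Existence of the decomposition *)

Section JointQuasiIso.
Variable R : comPzRingType.
Implicit Types (X Y : complex R) (n : int).

(** The maps [f i] exhibit the cohomology of [X] as the product of those of the
[Y_ i]; for finite [I] this is a quasi-isomorphism to the direct sum
([assemble_quasi_iso]). Families are easier to iterate than direct sums. *)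
Definition joint_quasi_iso X (I : Type) (Y_ : I -> complex R)
    (f : forall i, cmap X (Y_ i)) : Prop :=
  (forall n (x : X (n + 1)), diff X (n + 1) x = 0 ->
     (forall i, coboundary (f i (n + 1) x)) -> coboundary x) /\
  (forall n (y : forall i, Y_ i (n + 1)), (forall i, diff (Y_ i) (n + 1) (y i) = 0) ->
     exists2 x, diff X (n + 1) x = 0 & forall i, coboundary (y i - f i (n + 1) x)).

Lemma joint_quasi_iso_comp X (I : Type) (J : I -> Type) (Y_ : I -> complex R)
    (Z_ : forall i, J i -> complex R) (f : forall i, cmap X (Y_ i))
    (g : forall i j, cmap (Y_ i) (Z_ i j)) :
  joint_quasi_iso f -> (forall i, joint_quasi_iso (g i)) ->
  joint_quasi_iso
    (fun s : {i : I & J i} => cmap_comp (g (tag s) (tagged s)) (f (tag s))).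
Proof.
move=> [finj fsurj] qg; split=> [n x dx gfx|n z dz].
  apply: finj => // i; apply: (qg i).1; first exact: cocycle_cmap.
  by move=> j; exact: (gfx (Tagged J j)).
have H i : exists y, diff (Y_ i) (n + 1) y = 0 /\
    forall j, coboundary (z (Tagged J j) - g i j (n + 1) y).
  have [|y dy zy] := (qg i).2 n (fun j => z (Tagged J j)); last by exists y.
  by move=> j; exact: (dz (Tagged J j)).
pose y i := projT1 (cid (H i)).
have yP i : diff (Y_ i) (n + 1) (y i) = 0 /\
    forall j, coboundary (z (Tagged J j) - g i j (n + 1) (y i)).
  by rewrite /y; case: cid.
have [|x dx yx] := fsurj n y; first by move=> i; exact: (yP i).1.
exists x => // -[i j] /=.
have := coboundaryD ((yP i).2 j) (coboundary_cmap (g i j) (yx i)).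
by rewrite linearB addrA subrK.
Qed.

Lemma joint_coh_surj X (I : eqType) (Y_ : I -> complex R)
    (f : forall i, cmap X (Y_ i)) i : joint_quasi_iso f -> coh_surj (f i).
Proof.
move=> [_ fs] n y dy.
have [|x dx xP] := fs n (dfwith (fun i => 0 : Y_ i (n + 1)) y).
  by move=> j; case: dfwithP => // j' _; rewrite linear0.
by exists x => //; have := xP i; rewrite dfwith_in.
Qed.

Lemma joint_Supp X (I : eqType) (Y_ : I -> complex R)
    (f : forall i, cmap X (Y_ i)) i : joint_quasi_iso f -> Supp (Y_ i) `<=` Supp X.
Proof.
move=> /(@joint_coh_surj _ _ _ _ i) fs p; rewrite !SuppP; apply: contra_not.
exact: (coh_surj_torsion fs).
Qed.

Section Assemble.
Variables (X : complex R) (I : finType) (Y_ : I -> complex R).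
Variable f : forall i, cmap X (Y_ i).

Lemma assemble_linear n : linear (fun x : X n =>
  Dsum (finite_finset (X := [set i | f i n x != 0])) : dsum_cpx Y_ n).
Proof. by move=> c x y; apply: dsum_ext => i /=; rewrite linearP. Qed.

Lemma assemble_diff n (x : X n) : lin_of (@assemble_linear (n + 1)) (diff X n x)
  = diff (dsum_cpx Y_) n (lin_of (@assemble_linear n) x).
Proof. by apply: dsum_ext => i /=; rewrite cfun_diff. Qed.

Definition assemble : cmap X (dsum_cpx Y_) := CMap assemble_diff.

Lemma assemble_quasi_iso : joint_quasi_iso f -> quasi_iso assemble.
Proof.
move=> [fi fs]; apply/quasi_isoP; split=> n x dx.
  move=> [y xy]; apply: fi => // i; exists (y i).
  exact: (congr1 (fun z : dsum _ => z i) xy).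
have [|y dy xy] := fs n (fun i => x i).
  by move=> i; exact: (congr1 (fun z : dsum _ => z i) dx).
exists y => //; pose u i := projT1 (cid (xy i)).
exists (Dsum (finite_finset (X := [set i | u i != 0])) : dsum_cpx Y_ n).
apply: dsum_ext => i /=; rewrite /u; case: cid => /= v <-.
by rewrite scaleN1r.
Qed.
End Assemble.

(** The summands cut out by the two complementary idempotents. On the one of
index [c] the scalar [e (~~ c)] acts as the identity, hence [e c] as zero; since
e true + e false = 1, a class that passes from one summand to the other is
killed by 1. *)
Lemma perfect_split X (e : bool -> R) (k : forall n, {linear X (n + 1) -> X n}) :
  perfect X -> e true + e false = 1 ->
  (forall n x, k n (k (n + 1) x) = 0) ->
  (forall n x, (e true * e false) *: x
     = diff X n (k n x) + k (n + 1) (diff X (n + 1) x)) ->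
  exists (Y_ : bool -> complex R) (i : forall c, cmap X (Y_ c)),
    [/\ forall c, perfect (Y_ c), joint_quasi_iso i &
      forall c n (y : Y_ c (n + 1)), diff (Y_ c) (n + 1) y = 0 -> coboundary (e c *: y)].
Proof.
move=> pX e1 kk dk.
have e1c c : e c + e (~~ c) = 1 by case: c; rewrite //= addrC.
have /choice[T TP] : forall c, exists T : {Y : complex R & (cmap X Y * cmap Y X)%type},
  [/\ perfect (tag T),
     (forall n x, (tagged T).2 n ((tagged T).1 n x) = e (~~ c) *: x) &
     (forall n (y : tag T (n + 1)), diff (tag T) (n + 1) y = 0 ->
      coboundary (y - (tagged T).1 (n + 1) ((tagged T).2 (n + 1) y)))].
  move=> c; have [|Y [i [r YP]]] := homotopy_idempotent_split pX (e1c c) kk.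
    by move=> n x; rewrite -dk; case: c; rewrite //= mulrC.
  by exists (existT _ Y (i, r)).
pose Y_ c := tag (T c); pose i c : cmap X (Y_ c) := (tagged (T c)).1.
pose r c : cmap (Y_ c) X := (tagged (T c)).2.
have ri c n x : r c n (i c n x) = e (~~ c) *: x by have [_ h _] := TP c; exact: h.
have ir c n (y : Y_ c (n + 1)) : diff (Y_ c) (n + 1) y = 0 ->
  coboundary (y - i c (n + 1) (r c (n + 1) y)) by have [_ _ h] := TP c; exact: h.
have ey c n (y : Y_ c (n + 1)) : diff (Y_ c) (n + 1) y = 0 -> coboundary (e c *: y).
  move=> dy; set z := i c (n + 1) (r c (n + 1) y).
  have dz : diff (Y_ c) (n + 1) z = 0 by do 2!apply: cocycle_cmap.
  have -> : e c *: y = (y - z) + (z - i c (n + 1) (r c (n + 1) z)) - e (~~ c) *: (y - z).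
    rewrite {4}/z ri linearZ /= -/z subrKA scalerBr opprB addrA subrK.
    by rewrite -[X in _ = X - _]scale1r -(e1c c) scalerDl addrK.
  apply: coboundaryB; first by apply: coboundaryD; exact: ir.
  by apply: coboundaryZ; exact: ir.
exists Y_, i; split=> //; first by move=> c; have [] := TP c.
split=> [n x dx ix|n y dy].
  rewrite -[x]scale1r -e1 scalerDl -(ri false) -(ri true).
  by apply: coboundaryD; exact: coboundary_cmap.
have dr c : diff X (n + 1) (r c (n + 1) (y c)) = 0 by exact: cocycle_cmap.
exists (r true (n + 1) (y true) + r false (n + 1) (y false)).
  by rewrite linearD !dr addr0.
(* Both e c and e (~~ c) kill this class, and their sum is 1. *)
have cross c : coboundary (i c (n + 1) (r (~~ c) (n + 1) (y (~~ c)))).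
  set v := i c _ _; rewrite -[v]scale1r -(e1c c) scalerDl.
  apply: coboundaryD; first by apply: ey; exact: cocycle_cmap.
  by rewrite /v -!linearZ; do 2!apply: coboundary_cmap; exact: ey.
case; rewrite linearD.
  by rewrite opprD addrA; apply: coboundaryB; [exact: ir|exact: (cross true)].
by rewrite opprD addrCA addrC; apply: coboundaryB; [exact: ir|exact: (cross false)].
Qed.

End JointQuasiIso.

Section Existence.
Variable R : comPzRingType.
Hypothesis hR : noetherian R.

Definition vanish (S : set (Spec R)) : set R := [set c | forall p, S p -> spec_set p c].

Lemma vanish_ideal S : is_ideal (vanish S).
Proof.
split=> [p _|x y xS yS p Sp|a x xS p Sp].
- exact: (ideal0 (spec_ideal p)).
- by apply: (idealD (spec_ideal p)); [exact: xS|exact: yS].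
- by apply: (idealM (spec_ideal p)); exact: xS.
Qed.

(** The last clause makes the Noetherian induction progress: the scalar that
kills the cohomology of [Y_ c] vanishes on its support but at no point of the
other piece. *)
Lemma perfect_split_supports (X : complex R) (S : bool -> set (Spec R)) :
  perfect X -> thick_decomposition (Supp X) S ->
  exists (Y_ : bool -> complex R) (f : forall c, cmap X (Y_ c)),
    [/\ forall c, perfect (Y_ c), joint_quasi_iso f,
       forall c, Supp (Y_ c) `<=` S c &
       (forall c, S c !=set0) -> forall c, ~ (vanish (Supp (Y_ c)) `<=` vanish (Supp X))].
Proof.
move=> pX [tS dS XS]; have iX := null_homotopic_ideal X.
have zX : zeros [set c | null_homotopic c X] = \bigcup_b S b by rewrite -Supp_zeros.
have [e [e1 eS [m em]]] := separate_closed hR tS dS iX zX.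
have [u [v [w [uv1 uvw]]]] := coprime_power (m + m)%N e1.
pose e' c := e c * (if c then u else v).
have e'1 : e' true + e' false = 1 by [].
have e'S c p : S c p -> spec_set p (e' c).
  by move=> Sp; rewrite /e' mulrC; apply: (idealM (spec_ideal p)); exact: eS.
have [k0 [kk0 dk0]] := null_homotopic_square em.
have c2 : e' true * e' false
    = (e true * e false * w) * ((e true * e false) ^+ m) ^+ 2.
  rewrite [LHS]uvw -exprM muln2 -addnn exprSr; by move: (_ ^+ (m + m)) => c; ring.
pose z := e true * e false * w.
have kL n : linear (fun x => z *: k0 n x).
  by move=> a x y; rewrite linearP scalerDr !scalerA [z * a]mulrC.
have [|||Y_ [f [pY jf eY]]] := @perfect_split _ X e' (fun n => lin_of (kL n)) pX.
- by [].
- by move=> n x /=; rewrite linearZ /= kk0 !scaler0.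
- by move=> n x /=; rewrite c2 -/z -scalerA dk0 scalerDr linearZ.
have comax p c : spec_set p (e' c) -> ~ spec_set p (e' (~~ c)).
  move=> pc pc'; apply: (spec_proper (s := p)); rewrite -e'1.
  by apply: (idealD (spec_ideal p)); case: c pc pc'.
have SY c : Supp (Y_ c) `<=` S c.
  move=> p Yp; have [c' _ Sp] : (\bigcup_b S b) p
    by rewrite -XS; exact: joint_Supp jf _ Yp.
  have [->//|cc'] := eqVneq c c'.
  case/SuppP: Yp => n y dy; exists (e' c); last exact: eY.
  move=> /comax; apply; suff -> : ~~ c = c' by exact: e'S.
  by move: cc' {Sp}; case: (c) c' => [] [].
exists Y_, f; split=> // nS c YX.
have [p Sp] := nS (~~ c).
have pc : spec_set p (e' c).
  apply: YX; last by rewrite XS; exists (~~ c).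
  move=> q Yq; apply: contrapT => qc; case/SuppP: Yq => n y dy.
  by exists (e' c) => //; exact: eY.
exact: (comax p c pc (e'S _ _ Sp)).
Qed.

Lemma decomposition_exists (X : complex R) : perfect X ->
  exists (I : finType) (Y_ : I -> complex R) (f : forall i, cmap X (Y_ i)),
    [/\ forall i, perfect (Y_ i), joint_quasi_iso f,
      trivIset setT (fun i => Supp (Y_ i)) & forall i, indecomposable (Supp (Y_ i))].
Proof.
move: {2}(vanish _) (erefl (vanish (Supp X))) => K XK pX.
have iK : is_ideal K by rewrite -XK; exact: vanish_ideal.
move: K iK X XK pX; apply: (noetherian_ind hR) => K iK IH X XK pX.
have [X0|/set0P nX0] := eqVneq (Supp X) set0.
  exists void, (of_void _).
  exists (fun i : void => match i return cmap X (of_void _ i) with end).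
  split; [by case| |by case|by case].
  split=> [n x dx _|n y _].
    apply: (coboundary_local hR) => p.
    have : ~ Supp X p by rewrite X0.
    by move=> /not_SuppP; exact.
  by exists 0; [rewrite linear0|case].
have [iX|] := pselect (indecomposable (Supp X)).
  exists unit, (fun=> X), (fun=> cmap_id X); split=> //.
    split=> [n x dx|n y dy]; first by move/(_ tt).
    by exists (y tt) => // -[]; rewrite subrr; exact: coboundary0.
  by move=> [] [].
move=> nI; have [S [XS nS]] : exists S : bool -> set (Spec R),
    thick_decomposition (Supp X) S /\ forall b, S b !=set0.
  apply: contrapT => nS; apply: nI; split=> //.
  apply: closed_thick; rewrite (Supp_zeros pX).
  by exists [set c | null_homotopic c X] => //; exact: null_homotopic_ideal.
have [Y_ [f [pY jf YS YX]]] := perfect_split_supports pX XS.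
have H c : exists T : {I : finType &
      {Z_ : I -> complex R & forall i, cmap (Y_ c) (Z_ i)}},
    [/\ forall i, perfect (tag (tagged T) i), joint_quasi_iso (tagged (tagged T)),
      trivIset setT (fun i => Supp (tag (tagged T) i)) &
      forall i, indecomposable (Supp (tag (tagged T) i))].
  have [|||I [Z_ [g gP]]] := IH (vanish (Supp (Y_ c))) _ _ _ (Y_ c) erefl (pY c).
  - exact: vanish_ideal.
  - rewrite -XK => r Xr p /(joint_Supp jf); exact: Xr.
  - by rewrite -XK; exact: YX.
  by exists (existT _ I (existT _ Z_ g)).
pose T c := projT1 (cid (H c)).
have TP c := projT2 (cid (H c)); rewrite -/(T _) in TP.
exists {c : bool & tag (T c)}, (fun s => tag (tagged (T (tag s))) (tagged s)).
exists (fun s => cmap_comp (tagged (tagged (T (tag s))) (tagged s)) (f (tag s))).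
have ZY c i : Supp (tag (tagged (T c)) i) `<=` Supp (Y_ c).
  by have [_ jg _ _] := TP c; exact: joint_Supp jg.
split.
- by move=> [c i] /=; have [] := TP c.
- apply: (joint_quasi_iso_comp (J := fun c => tag (T c))
    (g := fun c i => tagged (tagged (T c)) i)) => // c.
  by have [] := TP c.
- move=> [c i] [c' i'] _ _ [p [/= pi pi']].
  have cc' : c = c'.
    have [_ dS _] := XS.
    by apply: (dS c c' I I); exists p; split; apply: YS; [exact: ZY pi|exact: ZY pi'].
  subst c'; congr existT.
  have [_ _ dT _] := TP c; by apply: (dT i i' I I); exists p.
- by move=> [c i] /=; have [] := TP c.
Qed.

End Existence.

(** * Uniqueness of the decomposition *)

Section PerfectLifting.
Variable R : comPzRingType.

Lemma perfect_lift_quasi_iso (P Y Z : complex R) (f : cmap Y Z) (c : cmap P Z) :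
  perfect P -> quasi_iso f -> exists phi : cmap P Y, homotopic (cmap_comp f phi) c.
Proof.
move=> pP qf.
have [|s -> [phi [h hP]]] := perfect_lift (@mult_closed1 R) (f := f) c pP.
  move=> n; have [fi fs] := qf n; split=> x dx.
    by move=> fx; exists 1 => //; rewrite scale1r; exact: fi.
  by have [y dy xy] := fs x dx; exists 1 => //; exists y; rewrite ?scale1r.
by exists phi, h => n x; rewrite -hP scale1r.
Qed.

Lemma perfect_quasi_iso (P Y : complex R) : perfect P -> D_iso P Y ->
  exists f : cmap P Y, quasi_iso f.
Proof.
move=> pP /D_isoP[A [l [r [ql qr]]]].
have [s ls] := perfect_lift_quasi_iso (cmap_id P) pP ql.
exists (cmap_comp r s); apply: quasi_iso_comp qr.
apply: quasi_iso_cancel_left ql.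
exact: quasi_iso_homotopic (homotopic_sym ls) (@quasi_iso_id _ P).
Qed.

Lemma D_iso_sym (X Y : complex R) : D_iso X Y -> D_iso Y X.
Proof. by move=> /D_isoP[A [l [r [ql qr]]]]; apply/D_isoP; exists A, r, l. Qed.

End PerfectLifting.

Section DsumComplex.
Variables (R : comPzRingType) (I : eqType) (X_ : I -> complex R).
Local Notation DX := (dsum_cpx X_).

Lemma cmap_proj_diff i n (x : DX n) :
  @dproj _ _ (fun j => X_ j (n + 1)) i (diff DX n x)
  = diff (X_ i) n (@dproj _ _ (fun j => X_ j n) i x).
Proof. by []. Qed.
Definition cmap_proj i : cmap DX (X_ i) :=
  @CMap _ DX (X_ i) (fun n => @dproj _ _ (fun j => X_ j n) i) (@cmap_proj_diff i).

Lemma cmap_in_diff i n (x : X_ i n) :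
  @din _ _ (fun j => X_ j (n + 1)) i (diff (X_ i) n x)
  = diff DX n (@din _ _ (fun j => X_ j n) i x).
Proof.
apply: dsum_ext => j; rewrite [RHS]/=; have [ij|ij] := pselect (i = j).
  by subst j; rewrite din_in din_fun_in.
by rewrite din_out // din_fun_out // linear0.
Qed.
Definition cmap_in i : cmap (X_ i) DX :=
  @CMap _ (X_ i) DX (fun n => lin_of (@din_linear _ _ (fun j => X_ j n) i))
    (@cmap_in_diff i).

Lemma cmap_proj_in i n (x : X_ i n) : cmap_proj i n (cmap_in i n x) = x.
Proof. exact: (@din_in _ _ (fun j => X_ j n)). Qed.

(** An element of a direct sum has finitely many nonzero components, so their
denominators have a common multiple. *)
Lemma dsum_coh_killed (S : set R) n (z : DX (n + 1)) : mult_closed S ->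
  (forall i, coh_killed S (cmap_proj i (n + 1) z)) -> coh_killed S z.
Proof.
move=> [S1 SM] zS; have [s sE] := (finite_seqP _).1 (dvalP z).
have [t St tz] : exists2 t, S t &
    forall i, i \in s -> coboundary (t *: cmap_proj i (n + 1) z).
  elim: s {sE} => [|i s [t St tz]]; first by exists 1.
  have [u Su uz] := zS i; exists (u * t); first exact: SM.
  move=> j; rewrite inE => /orP[/eqP->|js].
    by rewrite mulrC -scalerA; exact: coboundaryZ.
  by rewrite -scalerA; apply: coboundaryZ; exact: tz.
have H i : exists y : X_ i n, t *: z i = diff (X_ i) n y /\ (z i = 0 -> y = 0).
  have [z0|/eqP z0] := pselect (z i = 0).
    by exists 0; rewrite z0 scaler0 linear0.
  have [|y yE] := tz i; last by exists y; split=> // /eqP; rewrite (negbTE z0).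
  by have : [set` s] i by rewrite -sE.
pose y i := projT1 (cid (H i)).
have yP i : t *: z i = diff (X_ i) n (y i) /\ (z i = 0 -> y i = 0).
  exact: projT2 (cid (H i)).
have yfin : finite_set [set i | y i != 0].
  apply: (sub_finite_set _ (dvalP z)) => i /=.
  by apply: contra_neq => /(yP i).2.
exists t => //; exists (Dsum yfin : DX n).
by apply: dsum_ext => i; exact: (yP i).1.
Qed.

Lemma dsum_Supp : Supp DX = \bigcup_i Supp (X_ i).
Proof.
apply/seteqP; split=> p.
  move=> pX; apply: contrapT => np; move/SuppP: pX; apply => n z dz.
  apply: dsum_coh_killed => [|i]; first exact: mult_closed_prime.
  have /not_SuppP : ~ Supp (X_ i) p by move=> pi; apply: np; exists i.
  by apply; exact: cocycle_cmap.
move=> [i _]; rewrite !SuppP; apply: contra_not.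
apply: (coh_surj_torsion (f := cmap_proj i)) => n y dy.
exists (cmap_in i (n + 1) y); first exact: cocycle_cmap.
by rewrite cmap_proj_in subrr; exact: coboundary0.
Qed.

End DsumComplex.


Section Uniqueness.
Variable R : comPzRingType.
Hypothesis hR : noetherian R.

(** Let [P] be a perfect model of [X_ i]. The inclusion of [X_ i] lifts to a map
[phi : P -> X], and the composite P -> X -> Y_ j is shown to be a
quasi-isomorphism. All components other than [j], and all summands other than
[i], contribute nothing, by comparison of supports. *)
Lemma summand_iso (X : complex R) (I J : eqType) (X_ : I -> complex R)
    (Y_ : J -> complex R) (f : cmap X (dsum_cpx X_)) (g : cmap X (dsum_cpx Y_)) i j :
  quasi_iso f -> quasi_iso g -> in_Dbproj (X_ i) ->
  trivIset setT (fun i => Supp (X_ i)) -> trivIset setT (fun j => Supp (Y_ j)) ->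
  Supp (X_ i) = Supp (Y_ j) -> D_iso (X_ i) (Y_ j).
Proof.
move=> qf qg [P pP XP] dX dY XY.
have [al qal] := perfect_quasi_iso pP (D_iso_sym XP).
have [phi fphi] := perfect_lift_quasi_iso (cmap_comp (cmap_in X_ i) al) pP qf.
have [fi fs] := (quasi_isoP _).1 qf; have [gi gs] := (quasi_isoP _).1 qg.
have [ali als] := (quasi_isoP _).1 qal.
have PX : Supp P = Supp (X_ i) by exact: quasi_iso_Supp qal.
apply/D_isoP; exists P, al, (cmap_comp (cmap_proj Y_ j) (cmap_comp g phi)).
split=> //; apply/quasi_isoP; split=> n z dz.
  move=> /= psiz; apply: ali => //.
  have e := coh_homotopic fphi dz.
  suff phiz : coboundary (phi (n + 1) z).
    rewrite -[al _ z](cmap_proj_in (X_ := X_)); apply: coboundary_cmap.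
    rewrite -[X in coboundary X]opprK; apply: coboundaryN.
    apply: coboundary_sub (coboundaryN (coboundary_cmap f phiz)).
    by rewrite opprK addrC.
  (* The component at j vanishes by hypothesis, the others by disjointness of
     their supports from that of P. *)
  apply: gi; first exact: cocycle_cmap.
  have [_ ->] : coh_killed [set 1] (g (n + 1) (phi (n + 1) z)); last by rewrite scale1r.
  apply: dsum_coh_killed => [|j']; first exact: mult_closed1.
  exists 1 => //; rewrite scale1r; have [->//|/eqP jj'] := eqVneq j' j.
  apply: (coboundary_local hR) => p; have [pY|] := pselect (Supp (Y_ j') p); last first.
    by move=> /not_SuppP; apply; do 3!apply: cocycle_cmap.
  have /not_SuppP/(_ n z dz)[t pt tz] : ~ Supp P p.
    by rewrite PX XY => pY'; apply/jj'/(dY _ _ Logic.I Logic.I); exists p.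
  by exists t => //; rewrite -!linearZ; do 3!apply: coboundary_cmap.
have [|x dx xP] := gs n (cmap_in Y_ j (n + 1) z); first exact: cocycle_cmap.
have [|y dy yP] := als n (cmap_proj X_ i (n + 1) (f (n + 1) x)).
  by do 2!apply: cocycle_cmap.
(* The class w = x - phi y lifts the difference to be bounded. It has no
   component at [i], and its other components die at each p in Supp (Y_ j),
   while at the other p everything in Y_ j dies. *)
exists y => //=; set w := x - phi (n + 1) y.
have dw : diff X (n + 1) w = 0 by rewrite linearB dx cocycle_cmap // subr0.
have -> : z - cmap_proj Y_ j (n + 1) (g (n + 1) (phi (n + 1) y)) =
    cmap_proj Y_ j (n + 1) (cmap_in Y_ j (n + 1) z - g (n + 1) x)
    + cmap_proj Y_ j (n + 1) (g (n + 1) w).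
  by rewrite /w !linearB cmap_proj_in addrA subrK.
apply: coboundaryD; first exact: coboundary_cmap.
have fwi : coboundary (cmap_proj X_ i (n + 1) (f (n + 1) w)).
  have -> : cmap_proj X_ i (n + 1) (f (n + 1) w) =
      (cmap_proj X_ i (n + 1) (f (n + 1) x) - al (n + 1) y)
      - cmap_proj X_ i (n + 1)
          (f (n + 1) (phi (n + 1) y) - cmap_in X_ i (n + 1) (al (n + 1) y)).
    rewrite /w [f (n + 1) (_ - _)]linearB ![cmap_proj X_ i (n + 1) (_ - _)]linearB.
    by rewrite cmap_proj_in opprB addrA subrK.
  by apply: coboundaryB => //; apply: coboundary_cmap; exact: (coh_homotopic fphi dy).
apply: (coboundary_local hR) => p; have [pY|] := pselect (Supp (Y_ j) p); last first.
  by move=> /not_SuppP; apply; do 2!apply: cocycle_cmap.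
have [t pt tw] : coh_killed (away p) (f (n + 1) w).
  apply: dsum_coh_killed => [|i']; first exact: mult_closed_prime.
  have [->|/eqP ii'] := eqVneq i' i.
    by exists 1; [exact: spec_proper|rewrite scale1r].
  have /not_SuppP : ~ Supp (X_ i') p.
    by move=> pX; apply/ii'/(dX _ _ Logic.I Logic.I); exists p; split=> //=; rewrite XY.
  by apply; do 2!apply: cocycle_cmap.
exists t => //; rewrite -!linearZ; do 2!apply: coboundary_cmap.
by apply: fi; [rewrite linearZ /= dw scaler0|rewrite linearZ].
Qed.

End Uniqueness.

Theorem corollary1p4 (R : comPzRingType) (hR : noetherian R)
    (X : complex R) (hX : perfect X) :
  (exists (I : Type) (X_ : I -> complex R), support_decomposition X X_) /\
  (forall (I J : Type) (X_ : I -> complex R) (Y_ : J -> complex R),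
     support_decomposition X X_ -> support_decomposition X Y_ ->
     exists2 sigma : I -> J, bijective sigma &
       forall i, D_iso (X_ i) (Y_ (sigma i))).
Proof.
split=> [|I J X_ Y_ [Xobj Xiso Xdis Xind] [Yobj Yiso Ydis Yind]].
  have [I [Y_ [f [pY jf dY iY]]]] := decomposition_exists hR hX.
  exists I, Y_; split=> //.
    by move=> i; exists (Y_ i) => //; exact: D_iso_quasi_iso (@quasi_iso_id _ _).
  exact: D_iso_quasi_iso (assemble_quasi_iso jf).
have [f qf] := perfect_quasi_iso hX Xiso.
have [g qg] := perfect_quasi_iso hX Yiso.
have SE : \bigcup_i Supp (X_ i) = \bigcup_j Supp (Y_ j).
  rewrite -(dsum_Supp (X_ : {classic I} -> complex R)).
  rewrite -(dsum_Supp (Y_ : {classic J} -> complex R)).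
  by rewrite -(quasi_iso_Supp qf) -(quasi_iso_Supp qg).
have [sigma bs sE] := indecomposable_match Xind Yind Xdis Ydis SE.
exists sigma => // i.
exact: (@summand_iso R hR X {classic I} {classic J} X_ Y_ f g i (sigma i)).
Qed.
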